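(* Let $u=(p_{\mathrm{g,ref}},v_{\mathrm g})$ be a dispatch point and let $\gamma\ge 0$. Then $u$ is robustly feasible with respect to $\mathcal W(\gamma)$ if there exist internal state bounds $z^u=(\varphi^u,v^u_{\mathrm{pq}},\Delta^u)$, $z^\ell=(\varphi^\ell,v^\ell_{\mathrm{pq}},\Delta^\ell)$ with $z^\ell\le z^u$, vectors $g^u_{\mathcal P},g^\ell_{\mathcal P},\psi^u_{\mathcal P},\psi^\ell_{\mathcal P}\in\mathbb{R}^{n_{\mathrm g}+2n_{\mathrm l}+n_{\mathrm b}}$, reactive power bounds $q_{\mathrm g}^\ell,q_{\mathrm g}^u\in\mathbb{R}^{n_{\mathrm g}}$ and line flow bounds $s_{\mathrm p}^{\mathrm f,u},s_{\mathrm q}^{\mathrm f,u},s_{\mathrm p}^{\mathrm t,u},s_{\mathrm q}^{\mathrm t,u}\in\mathbb{R}^{n_{\mathrm l}}$ satisfying all of the following. (1) Residual bounds: for all $i=1,\dots,n_{\mathrm g}$, $l=1,\dots,n_{\mathrm l}$, $k=1,\dots,n_{\mathrm b}$, and all $v_l^{\mathrm f}\in\{v_l^{\mathrm f,\ell},v_l^{\mathrm f,u}\}$, $v_l^{\mathrm t}\in\{v_l^{\mathrm t,\ell},v_l^{\mathrm t,u}\}$, $\varphi_l\in\{\varphi_l^\ell,\varphi_l^u\}$, $v_k\in\{v_k^\ell,v_k^u\}$: $$g_{\mathcal P,i}^{\mathrm p,\ell}\le g_i^{\mathrm p,\ell}(p_{\mathrm{g,ref},i}),\quad g_i^{\mathrm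 p,u}(p_{\mathrm{g,ref},i})\le g_{\mathcal P,i}^{\mathrm p,u},$$ $$g_{\mathcal P,l}^{\cos,\ell}\le g_l^{\cos,\ell}(v_l^{\mathrm f},v_l^{\mathrm t},\varphi_l),\quad g_l^{\cos,u}(v_l^{\mathrm f},v_l^{\mathrm t},\varphi_l)\le g_{\mathcal P,l}^{\cos,u},$$ $$g_{\mathcal P,l}^{\sin,\ell}\le g_l^{\sin,\ell}(v_l^{\mathrm f},v_l^{\mathrm t},\varphi_l),\quad g_l^{\sin,u}(v_l^{\mathrm f},v_l^{\mathrm t},\varphi_l)\le g_{\mathcal P,l}^{\sin,u},$$ $$g_{\mathcal P,k}^{\mathrm v,\ell}\le g_k^{\mathrm v,\ell}(v_k),\quad g_k^{\mathrm v,u}(v_k)\le g_{\mathcal P,k}^{\mathrm v,u}.$$ (2) Basis function bounds: for all $i=1,\dots,n_{\mathrm g}$, $l=1,\dots,n_{\mathrm l}$, $k=1,\dots,n_{\mathrm b}$, and all $\Delta\in\{\Delta^\ell,\Delta^u\}$, $v_l^{\mathrm f}\in\{v_l^{\mathrm f,\ell},v_l^{\mathrm f,u}\}$, $v_l^{\mathrm t}\in\{v_l^{\mathrm t,\ell},v_l^{\mathrm t,u}\}$, $\varphi_l\in\{\varphi_l^\ell,\varphi_l^u\}$, $v_k\in\{v_k^\ell,v_k^u\}$: $$\psi_{\mathcal P,i}^{\mathrm p,\ell}\le \psi_i^{\mathrm p,\ell}(p_{\mathrm{g,ref},i},\Delta),\quad \psi_i^{\mathrm p,u}(p_{\mathrm{g,ref},i},\Delta)\le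 \psi_{\mathcal P,i}^{\mathrm p,u},$$ $$\psi_{\mathcal P,l}^{\cos,\ell}\le \psi_l^{\cos,\ell}(v_l^{\mathrm f},v_l^{\mathrm t},\varphi_l),\quad \psi_l^{\cos,u}(v_l^{\mathrm f},v_l^{\mathrm t},\varphi_l)\le \psi_{\mathcal P,l}^{\cos,u},$$ $$\psi_{\mathcal P,l}^{\sin,\ell}\le \psi_l^{\sin,\ell}(v_l^{\mathrm f},v_l^{\mathrm t},\varphi_l),\quad \psi_l^{\sin,u}(v_l^{\mathrm f},v_l^{\mathrm t},\varphi_l)\le \psi_{\mathcal P,l}^{\sin,u},$$ $$\psi_{\mathcal P,k}^{\mathrm{quad},\ell}\le \psi_k^{\mathrm{quad},\ell}(v_k),\quad \psi_k^{\mathrm{quad},u}(v_k)\le \psi_{\mathcal P,k}^{\mathrm{quad},u}.$$ (3) $K^+g^u_{\mathcal P}+K^-g^\ell_{\mathcal P}+\xi^u(\gamma)\le z^u$ and $K^+g^\ell_{\mathcal P}+K^-g^u_{\mathcal P}+\xi^\ell(\gamma)\ge z^\ell$, where for $i=1,\dots,n_{\mathrm l}+n_{\mathrm{pq}}+1$ $$\xi^u_i(\gamma)=-A_iJ_{f,(0)}^{-1}Rw^{(0)}+\gamma\lVert A_iJ_{f,(0)}^{-1}R\,\Sigma^{1/2}\rVert_2,\qquad \xi^\ell_i(\gamma)=-A_iJ_{f,(0)}^{-1}Rw^{(0)}-\gamma\lVert A_iJ_{f,(0)}^{-1}R\,\Sigma^{1/2}\rVert_2 .$$ (4) Operational limits: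 $p_{\mathrm g,i}^{\min}\le p_{\mathrm{g,ref},i}+\alpha_i\Delta^\ell$, $\;p_{\mathrm{g,ref},i}+\alpha_i\Delta^u\le p_{\mathrm g,i}^{\max}$, $\;q_{\mathrm g,i}^{\min}\le q_{\mathrm g,i}^\ell$, $\;q_{\mathrm g,i}^u\le q_{\mathrm g,i}^{\max}$, $\;v_{\mathrm g,i}^{\min}\le v_{\mathrm g,i}\le v_{\mathrm g,i}^{\max}$ for $i=1,\dots,n_{\mathrm g}$; $\;v_{\mathrm{pq},i}^{\min}\le v_{\mathrm{pq},i}^\ell$, $\;v_{\mathrm{pq},i}^u\le v_{\mathrm{pq},i}^{\max}$ for $i=1,\dots,n_{\mathrm{pq}}$; and $\varphi_l^{\min}\le\varphi_l^\ell$, $\;\varphi_l^u\le\varphi_l^{\max}$, $\;(s_{\mathrm p,l}^{\mathrm f,u})^2+(s_{\mathrm q,l}^{\mathrm f,u})^2\le(s_l^{\max})^2$, $\;(s_{\mathrm p,l}^{\mathrm t,u})^2+(s_{\mathrm q,l}^{\mathrm t,u})^2\le(s_l^{\max})^2$ for $l=1,\dots,n_{\mathrm l}$. (5) Reactive power bounds: $$L_{\mathrm q}^+\psi^u_{\mathcal P}+L_{\mathrm q}^-\psi^\ell_{\mathcal P}+\zeta^u(\gamma)\le C_{\mathrm{g,pv}}\,q_{\mathrm g}^u,\qquad L_{\mathrm q}^-\psi^u_{\mathcal P}+L_{\mathrm q}^+\psi^\ell_{\mathcal P}+\zeta^\ell(\gamma)\ge C_{\mathrm{g,pv}}\,q_{\mathrm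 g}^\ell,$$ where, for each PV bus $i$, $\zeta_i^u(\gamma)=C_{\mathrm{d,pv},i}\,q_{\mathrm d}^{(0)}+\gamma\lVert C_{\mathrm{d,pv},i}\Sigma_{\mathrm q}^{1/2}\rVert_2$ and $\zeta_i^\ell(\gamma)=C_{\mathrm{d,pv},i}\,q_{\mathrm d}^{(0)}-\gamma\lVert C_{\mathrm{d,pv},i}\Sigma_{\mathrm q}^{1/2}\rVert_2$. (6) Line flow bounds: for $\mathrm k\in\{\mathrm f,\mathrm t\}$ and $\mathrm j\in\{\mathrm p,\mathrm q\}$, $$L_{\mathrm{j,line}}^{\mathrm k,+}\psi^u_{\mathcal P}+L_{\mathrm{j,line}}^{\mathrm k,-}\psi^\ell_{\mathcal P}\le s_{\mathrm j}^{\mathrm k,u},\qquad -L_{\mathrm{j,line}}^{\mathrm k,-}\psi^u_{\mathcal P}-L_{\mathrm{j,line}}^{\mathrm k,+}\psi^\ell_{\mathcal P}\le s_{\mathrm j}^{\mathrm k,u}.$$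
   Context: **Network.** A power grid has $n_{\mathrm b}$ buses, $n_{\mathrm l}$ lines, $n_{\mathrm g}$ generators and $n_{\mathrm d}$ loads. Each line $l$ has a from bus and a to bus; superscripts $\mathrm f,\mathrm t$ with index $l$ denote quantities at these buses (e.g. $v_l^{\mathrm f}$ is the voltage magnitude at the from bus of $l$). Buses are split into $n_{\mathrm{pv}}$ PV buses (those with generators) and $n_{\mathrm{pq}}$ PQ buses (the others). $E\in\mathbb{R}^{n_{\mathrm b}\times n_{\mathrm l}}$ is the incidence matrix ($+1$ at the from bus, $-1$ at the to bus), and $E_{\mathrm f},E_{\mathrm t}\in\{0,1\}^{n_{\mathrm b}\times n_{\mathrm l}}$ are the from/to connection matrices, $E=E_{\mathrm f}-E_{\mathrm t}$. $C_{\mathrm g}\in\mathbb{R}^{n_{\mathrm b}\times n_{\mathrm g}}$, $C_{\mathrm d}\in\mathbb{R}^{n_{\mathrm b}\times n_{\mathrm d}}$ are the 0/1 connection matrices of generators and loads. $G^{\mathrm c},G^{\mathrm s},B^{\mathrm c},B^{\mathrm s}\in\mathbb{R}^{n_{\mathrm b}\times n_{\mathrm l}}$, diagonal $G^{\mathrm d},B^{\mathrm d}\in\mathbb{R}^{n_{\mathrm b}\times n_{\mathrm b}}$, and diagonal $G_{\mathrm{ff}},G_{\mathrm{ft}},G_{\mathrm{tf}},G_{\mathrm{tt}},B_{\mathrm{ff}},B_{\mathrm{ft}},B_{\mathrm{tf}},B_{\mathrm{tt}}\in\mathbb{R}^{n_{\mathrm l}\times n_{\mathrm l}}$ are given real (admittance)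 matrices. Subscripts $\mathrm{pq}$, $\mathrm{pv}$ on a matrix select the rows of PQ, PV buses. One bus is the reference, with angle $0$; subscript $\mathrm{ns}$ selects non-reference buses. All limits with superscripts $\min$, $\max$ are given constants with each $\min$ at most the corresponding $\max$, and $s_l^{\max}\ge0$; $v_{\mathrm g,i}^{\min/\max}$ and $v_{\mathrm{pq},i}^{\min/\max}$ are the voltage limits of the corresponding buses. **Variables.** Dispatch point: $u=(p_{\mathrm{g,ref}},v_{\mathrm g})\in\mathbb{R}^{2n_{\mathrm g}}$ (active power setpoints and voltage magnitudes at generator buses; generators at the same bus share the same voltage setpoint). Uncertain variable: $w=(p_{\mathrm d},q_{\mathrm d})\in\mathbb{R}^{2n_{\mathrm d}}$. Internal state: $x=(\theta_{\mathrm{ns}},v_{\mathrm{pq}},\Delta)\in\mathbb{R}^{n_{\mathrm b}+n_{\mathrm{pq}}}$. Angle differences are $\varphi=E_{\mathrm{ns}}^T\theta_{\mathrm{ns}}$. $A=\mathbf{blkdiag}(E_{\mathrm{ns}}^T,I_{n_{\mathrm{pq}}},1)$, so $Ax=(\varphi,v_{\mathrm{pq}},\Delta)$; $A_i$ is its $i$-th row. Participation factors $\alpha_i$ (generation shares, $\alpha_i\ge 0$) are fixed constants; generator $i$ outputs $p_{\mathrm g,i}=p_{\mathrm{g,ref},i}+\alpha_i\Delta$. **Power flow.** $\psi(x,u)=(\psi^{\mathrm p},\psi^{\cos},\psi^{\sin},\psi^{\mathrm{quad}})\in\mathbb{R}^{n_{\mathrm g}+2n_{\mathrm l}+n_{\mathrm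 b}}$, where $\psi_i^{\mathrm p}=p_{\mathrm{g,ref},i}+\alpha_i\Delta$, $\psi_l^{\cos}=v_l^{\mathrm f}v_l^{\mathrm t}\cos\varphi_l$, $\psi_l^{\sin}=v_l^{\mathrm f}v_l^{\mathrm t}\sin\varphi_l$, $\psi_k^{\mathrm{quad}}=v_k^2$. Active balance at all buses and reactive balance at PQ buses read $M\psi(x,u)+Rw=0$ with $$M=\begin{bmatrix}C_{\mathrm g}&-G^{\mathrm c}&-B^{\mathrm s}&-G^{\mathrm d}\\ \mathbf 0&B^{\mathrm c}_{\mathrm{pq}}&-G^{\mathrm s}_{\mathrm{pq}}&B^{\mathrm d}_{\mathrm{pq}}\end{bmatrix},\qquad R=-\begin{bmatrix}C_{\mathrm d}&\mathbf 0\\ \mathbf 0&C_{\mathrm{d,pq}}\end{bmatrix}.$$ Reactive balance at PV buses reads $C_{\mathrm{g,pv}}q_{\mathrm g}-C_{\mathrm{d,pv}}q_{\mathrm d}=L_{\mathrm q}\psi(x,u)$ with $L_{\mathrm q}=[\mathbf 0\;\;-B^{\mathrm c}_{\mathrm{pv}}\;\;G^{\mathrm s}_{\mathrm{pv}}\;\;-B^{\mathrm d}_{\mathrm{pv}}]$. Line flows are $s_{\mathrm j}^{\mathrm k}=L_{\mathrm{j,line}}^{\mathrm k}\psi(x,u)$ for $\mathrm k\in\{\mathrm f,\mathrm t\}$, $\mathrm j\in\{\mathrm p,\mathrm q\}$, where $L_{\mathrm{p,line}}^{\mathrm f}=[\mathbf 0\;\;G_{\mathrm{ft}}\;\;-B_{\mathrm{ft}}\;\;G_{\mathrm{ff}}E_{\mathrm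 f}^T]$, $L_{\mathrm{q,line}}^{\mathrm f}=[\mathbf 0\;\;-B_{\mathrm{ft}}\;\;-G_{\mathrm{ft}}\;\;-B_{\mathrm{ff}}E_{\mathrm f}^T]$, $L_{\mathrm{p,line}}^{\mathrm t}=[\mathbf 0\;\;G_{\mathrm{tf}}\;\;-B_{\mathrm{tf}}\;\;G_{\mathrm{tt}}E_{\mathrm t}^T]$, $L_{\mathrm{q,line}}^{\mathrm t}=[\mathbf 0\;\;-B_{\mathrm{tf}}\;\;-G_{\mathrm{tf}}\;\;-B_{\mathrm{tt}}E_{\mathrm t}^T]$. **Uncertainty set.** $\mathcal W(\gamma)=\{w\mid (w-w^{(0)})^T\Sigma^{-1}(w-w^{(0)})\le\gamma^2\}$ with nominal value $w^{(0)}=(p_{\mathrm d}^{(0)},q_{\mathrm d}^{(0)})$, $\Sigma$ symmetric positive definite, $\Sigma^{1/2}$ its Cholesky factor, $\Sigma=\Sigma^{1/2}(\Sigma^{1/2})^T$; $\Sigma_{\mathrm q}^{1/2}$ consists of the last $n_{\mathrm d}$ rows of $\Sigma^{1/2}$ (those corresponding to $q_{\mathrm d}$). **Robust feasibility.** $u$ is robustly feasible with respect to $\mathcal W(\gamma)$ if for all $w\in\mathcal W(\gamma)$ there exist $x=(\theta_{\mathrm{ns}},v_{\mathrm{pq}},\Delta)$ and reactive generation $q_{\mathrm g}\in\mathbb{R}^{n_{\mathrm g}}$ such that the active and reactive power balance equations hold at all buses (i.e. $M\psi(x,u)+Rw=0$ and $C_{\mathrm{g,pv}}q_{\mathrm g}-C_{\mathrm{d,pv}}q_{\mathrm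 d}=L_{\mathrm q}\psi(x,u)$) and the operational limits hold: $p_{\mathrm g,i}^{\min}\le p_{\mathrm{g,ref},i}+\alpha_i\Delta\le p_{\mathrm g,i}^{\max}$, $q_{\mathrm g,i}^{\min}\le q_{\mathrm g,i}\le q_{\mathrm g,i}^{\max}$, $v_k^{\min}\le v_k\le v_k^{\max}$ at every bus, $\varphi_l^{\min}\le\varphi_l\le\varphi_l^{\max}$, $(s_{\mathrm p,l}^{\mathrm f})^2+(s_{\mathrm q,l}^{\mathrm f})^2\le(s_l^{\max})^2$ and $(s_{\mathrm p,l}^{\mathrm t})^2+(s_{\mathrm q,l}^{\mathrm t})^2\le(s_l^{\max})^2$ for every line. **Nominal point and Jacobians.** $(x^{(0)},u^{(0)})$ is a fixed nominal operating point solving the power flow equations with $w=w^{(0)}$. $J_{\psi,(0)}=\nabla_x\psi|_{(x^{(0)},u^{(0)})}$ and $J_{f,(0)}=MJ_{\psi,(0)}$, assumed non-singular. $K=-AJ_{f,(0)}^{-1}M$. For any matrix $X$ (such as $K$, $L_{\mathrm q}$, $L_{\mathrm{j,line}}^{\mathrm k}$), $X^+_{ij}=\max\{X_{ij},0\}$, $X^-_{ij}=\min\{X_{ij},0\}$. **Residuals and envelopes.** $g(x,u)=\psi(x,u)-J_{\psi,(0)}x$, with blocks $g^{\mathrm p},g^{\cos},g^{\sin},g^{\mathrm v}$ (residuals of $\psi^{\mathrm p},\psi^{\cos},\psi^{\sin},\psi^{\mathrm{quad}}$); $g_i^{\mathrm p}=p_{\mathrm{g,ref},i}$, $g_l^{\cos},g_l^{\sin}$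 depend only on $(v_l^{\mathrm f},v_l^{\mathrm t},\varphi_l)$, and $g_k^{\mathrm v}$ only on $v_k$. For each component of $g$ and of $\psi$, fixed functions of the same arguments with superscripts $\ell$ (concave) and $u$ (convex) are given, with $g^{\ell}\le g\le g^{u}$ and $\psi^\ell\le\psi\le\psi^u$ for all arguments within the operational limits $v_k^{\min}\le v_k\le v_k^{\max}$, $\varphi_l^{\min}\le\varphi_l\le\varphi_l^{\max}$ (and all values of $p_{\mathrm{g,ref},i}$, $\Delta$). The vectors $g_{\mathcal P}^{u},g_{\mathcal P}^\ell$ (and $\psi_{\mathcal P}^u,\psi_{\mathcal P}^\ell$) are split into blocks in the same way. **State bounds.** For a PQ bus $k$, $v_k^\ell,v_k^u$ are the corresponding entries of $v_{\mathrm{pq}}^\ell,v_{\mathrm{pq}}^u$; for a PV bus, $v_k^\ell=v_k^u$ equals the setpoint in $v_{\mathrm g}$. $v_l^{\mathrm f,\ell}$ etc. denote these bounds at the from/to bus of line $l$. Vector inequalities are componentwise. *)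

(* Defs.v *)
From HB Require Import structures.
From mathcomp Require Import all_boot all_order all_algebra.
From mathcomp Require Import boolp classical_sets reals topology normedtype.
From mathcomp Require Import derive trigo convex.

Set Implicit Arguments.
Unset Strict Implicit.
Unset Printing Implicit Defensive.

Import Order.TTheory GRing.Theory Num.Theory.
Import numFieldNormedType.Exports.

Local Open Scope ring_scope.
Local Open Scope classical_set_scope.

(* The norm MathComp-Analysis puts on matrices is the sup norm, hence this one. *)
Definition norm2 (R : realType) n (r : 'rV[R]_n) : R :=
  Num.sqrt (\sum_j r 0 j ^+ 2).

Definition cvle (R : realType) n (a b : 'cV[R]_n) : Prop :=
  forall i, a i 0 <= b i 0.

Definition posmx (R : realType) m n (X : 'M[R]_(m, n)) : 'M[R]_(m, n) :=
  map_mx (fun a => Num.max a 0) X.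

Definition negmx (R : realType) m n (X : 'M[R]_(m, n)) : 'M[R]_(m, n) :=
  map_mx (fun a => Num.min a 0) X.

Definition posdefmx (R : realType) n (S : 'M[R]_n) : Prop :=
  S^T = S /\ forall a : 'cV[R]_n, a != 0 -> 0 < (a^T *m S *m a) 0 0.

(* [is_trig_mx] is lower triangularity. *)
Definition cholesky_factor (R : realType) n (S L : 'M[R]_n) : Prop :=
  [/\ is_trig_mx L, forall i, 0 < L i i & S = L *m L^T].

Definition convex_on_space (R : realType) (E : lmodType R) (f : E -> R) : Prop :=
  @convex_function R E setT f.

Definition concave_on_space (R : realType) (E : lmodType R) (f : E -> R) : Prop :=
  convex_on_space (fun a => - f a).

(* The connection matrices are given by the bus to which each generator, load
   and line end is attached; distinctness of the two ends of a line is what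
   makes every column of the incidence matrix have one +1 and one -1. *)
Record grid (R : realType) (nb nl ng nd : nat) := Grid {
  from_bus : 'I_nl -> 'I_nb;
  to_bus : 'I_nl -> 'I_nb;
  gen_bus : 'I_ng -> 'I_nb;
  load_bus : 'I_nd -> 'I_nb;
  ref_bus : 'I_nb;
  Gc : 'M[R]_(nb, nl);
  Gs : 'M[R]_(nb, nl);
  Bc : 'M[R]_(nb, nl);
  Bs : 'M[R]_(nb, nl);
  Gd : 'M[R]_nb;
  Bd : 'M[R]_nb;
  Gff : 'M[R]_nl;
  Gft : 'M[R]_nl;
  Gtf : 'M[R]_nl;
  Gtt : 'M[R]_nl;
  Bff : 'M[R]_nl;
  Bft : 'M[R]_nl;
  Btf : 'M[R]_nl;
  Btt : 'M[R]_nl;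
  alpha : 'cV[R]_ng;
  pg_min : 'cV[R]_ng;
  pg_max : 'cV[R]_ng;
  qg_min : 'cV[R]_ng;
  qg_max : 'cV[R]_ng;
  v_min : 'cV[R]_nb;
  v_max : 'cV[R]_nb;
  phi_min : 'cV[R]_nl;
  phi_max : 'cV[R]_nl;
  s_max : 'cV[R]_nl;
  line_ends_neq : forall l, from_bus l != to_bus l;
  diag_Gd_Bd : is_diag_mx Gd /\ is_diag_mx Bd;
  diag_G_line : [/\ is_diag_mx Gff, is_diag_mx Gft, is_diag_mx Gtf & is_diag_mx Gtt];
  diag_B_line : [/\ is_diag_mx Bff, is_diag_mx Bft, is_diag_mx Btf & is_diag_mx Btt];
  alpha_ge0 : forall i, 0 <= alpha i 0;
  pg_min_max : cvle pg_min pg_max;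
  qg_min_max : cvle qg_min qg_max;
  v_min_max : cvle v_min v_max;
  phi_min_max : cvle phi_min phi_max;
  s_max_ge0 : forall l, 0 <= s_max l 0
}.

(* Bounds on the components of the residual and of the basis functions, as
   functions of p_(g,ref),i, of (v^f_l, v^t_l, phi_l), of v_k, and of
   (p_(g,ref),i, Delta). *)
Record envelopes (R : realType) (nb nl ng : nat) := Envelopes {
  gp_lo : 'I_ng -> R -> R;
  gp_hi : 'I_ng -> R -> R;
  gcos_lo : 'I_nl -> R * R * R -> R;
  gcos_hi : 'I_nl -> R * R * R -> R;
  gsin_lo : 'I_nl -> R * R * R -> R;
  gsin_hi : 'I_nl -> R * R * R -> R;
  gv_lo : 'I_nb -> R -> R;
  gv_hi : 'I_nb -> R -> R;
  psip_lo : 'I_ng -> R * R -> R;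
  psip_hi : 'I_ng -> R * R -> R;
  psicos_lo : 'I_nl -> R * R * R -> R;
  psicos_hi : 'I_nl -> R * R * R -> R;
  psisin_lo : 'I_nl -> R * R * R -> R;
  psisin_hi : 'I_nl -> R * R * R -> R;
  psiquad_lo : 'I_nb -> R -> R;
  psiquad_hi : 'I_nb -> R -> R
}.

Section Blocks.
Context {R : realType}.

Definition pgref n (u : 'cV[R]_(n + n)) : 'cV[R]_n := usubmx u.
Definition vgen n (u : 'cV[R]_(n + n)) : 'cV[R]_n := dsubmx u.

Definition qd n (w : 'cV[R]_(n + n)) : 'cV[R]_n := dsubmx w.

(* Used both for (theta_ns, v_pq, Delta) and for (phi, v_pq, Delta). *)
Definition ang_of m n (z : 'cV[R]_(m + n + 1)) : 'cV[R]_m := usubmx (usubmx z).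
Definition vpq_of m n (z : 'cV[R]_(m + n + 1)) : 'cV[R]_n := dsubmx (usubmx z).
Definition Delta_of m n (z : 'cV[R]_(m + n + 1)) : R := dsubmx z 0 0.

Definition p_blk ng nl nb (y : 'cV[R]_(ng + nl + nl + nb)) : 'cV[R]_ng :=
  usubmx (usubmx (usubmx y)).
Definition cos_blk ng nl nb (y : 'cV[R]_(ng + nl + nl + nb)) : 'cV[R]_nl :=
  dsubmx (usubmx (usubmx y)).
Definition sin_blk ng nl nb (y : 'cV[R]_(ng + nl + nl + nb)) : 'cV[R]_nl :=
  dsubmx (usubmx y).
Definition v_blk ng nl nb (y : 'cV[R]_(ng + nl + nl + nb)) : 'cV[R]_nb :=
  dsubmx y.

End Blocks.

(* (n_b - 1) + n_pq + 1 = n_b + n_pq, as there is at least the reference bus. *)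
Lemma state_dim nb (r : 'I_nb) n : (nb.-1 + n + 1 = nb + n)%N.
Proof. by case: nb r => [[]//|nb] _ /=; rewrite addn1 addSn. Qed.

Section PowerFlow.
Context {R : realType} {nb nl ng nd : nat} (N : grid R nb nl ng nd).

Definition pv_buses : {set 'I_nb} := [set gen_bus N i | i : 'I_ng]%SET.
Definition pq_buses : {set 'I_nb} := (~: pv_buses)%SET.
Definition npv := #|pv_buses|.
Definition npq := #|pq_buses|.
Definition pv_bus (i : 'I_npv) : 'I_nb := enum_val i.
Definition pq_bus (i : 'I_npq) : 'I_nb := enum_val i.

Definition Ef : 'M[R]_(nb, nl) := \matrix_(k, l) (from_bus N l == k)%:R.
Definition Et : 'M[R]_(nb, nl) := \matrix_(k, l) (to_bus N l == k)%:R.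
Definition E : 'M[R]_(nb, nl) := Ef - Et.
Definition Cg : 'M[R]_(nb, ng) := \matrix_(k, i) (gen_bus N i == k)%:R.
Definition Cd : 'M[R]_(nb, nd) := \matrix_(k, i) (load_bus N i == k)%:R.

Definition pq_rows n (X : 'M[R]_(nb, n)) : 'M[R]_(npq, n) := rowsub pq_bus X.
Definition pv_rows n (X : 'M[R]_(nb, n)) : 'M[R]_(npv, n) := rowsub pv_bus X.
Definition Ens : 'M[R]_(nb.-1, nl) := row' (ref_bus N) E.

Definition state_blocks (x : 'cV[R]_(nb + npq)) : 'cV[R]_(nb.-1 + npq + 1) :=
  castmx (esym (state_dim (ref_bus N) npq), erefl) x.

Definition A_mx : 'M[R]_(nl + npq + 1, nb + npq) :=
  castmx (erefl, state_dim (ref_bus N) npq)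
    (block_mx (block_mx Ens^T 0 0 1%:M) 0 0 1%:M).

Definition is_dispatch (u : 'cV[R]_(ng + ng)) : Prop :=
  forall i j, gen_bus N i = gen_bus N j -> vgen u i 0 = vgen u j 0.

(* Voltage magnitude of bus k: the setpoint of a generator at k if there is
   one, and otherwise the entry of [vpq] for k (the only term of the sum). *)
Definition bus_volt (vpq : 'cV[R]_npq) (vg : 'cV[R]_ng) (k : 'I_nb) : R :=
  if [pick i | gen_bus N i == k] is Some i then vg i 0
  else \sum_(j | pq_bus j == k) vpq j 0.

Definition volt (x : 'cV[R]_(nb + npq)) (u : 'cV[R]_(ng + ng)) : 'cV[R]_nb :=
  \col_k bus_volt (vpq_of (state_blocks x)) (vgen u) k.

Definition phi (x : 'cV[R]_(nb + npq)) : 'cV[R]_nl :=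
  Ens^T *m ang_of (state_blocks x).

Definition Delta (x : 'cV[R]_(nb + npq)) : R := Delta_of (state_blocks x).

Definition pgen (x : 'cV[R]_(nb + npq)) (u : 'cV[R]_(ng + ng)) : 'cV[R]_ng :=
  \col_i (pgref u i 0 + alpha N i 0 * Delta x).

Definition psi (x : 'cV[R]_(nb + npq)) (u : 'cV[R]_(ng + ng)) :
    'cV[R]_(ng + nl + nl + nb) :=
  let v k := volt x u k 0 in
  let vf l := v (from_bus N l) in
  let vt l := v (to_bus N l) in
  col_mx (col_mx (col_mx
    (pgen x u)
    (\col_l (vf l * vt l * cos (phi x l 0))))
    (\col_l (vf l * vt l * sin (phi x l 0))))
    (\col_k (v k ^+ 2)).

Definition M_mx : 'M[R]_(nb + npq, ng + nl + nl + nb) :=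
  col_mx
    (row_mx (row_mx (row_mx Cg (- Gc N)) (- Bs N)) (- Gd N))
    (row_mx (row_mx (row_mx 0 (pq_rows (Bc N))) (- pq_rows (Gs N)))
       (pq_rows (Bd N))).

Definition R_mx : 'M[R]_(nb + npq, nd + nd) :=
  - block_mx Cd 0 0 (pq_rows Cd).

Definition Lq : 'M[R]_(npv, ng + nl + nl + nb) :=
  row_mx (row_mx (row_mx 0 (- pv_rows (Bc N))) (pv_rows (Gs N)))
    (- pv_rows (Bd N)).

Definition Lpf : 'M[R]_(nl, ng + nl + nl + nb) :=
  row_mx (row_mx (row_mx 0 (Gft N)) (- Bft N)) (Gff N *m Ef^T).
Definition Lqf : 'M[R]_(nl, ng + nl + nl + nb) :=
  row_mx (row_mx (row_mx 0 (- Bft N)) (- Gft N)) (- (Bff N *m Ef^T)).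
Definition Lpt : 'M[R]_(nl, ng + nl + nl + nb) :=
  row_mx (row_mx (row_mx 0 (Gtf N)) (- Btf N)) (Gtt N *m Et^T).
Definition Lqt : 'M[R]_(nl, ng + nl + nl + nb) :=
  row_mx (row_mx (row_mx 0 (- Btf N)) (- Gtf N)) (- (Btt N *m Et^T)).

Definition power_flow x u (w : 'cV[R]_(nd + nd)) : Prop :=
  M_mx *m psi x u + R_mx *m w = 0.

Definition pv_reactive_balance x u (w : 'cV[R]_(nd + nd)) (qg : 'cV[R]_ng) :
    Prop :=
  pv_rows Cg *m qg - pv_rows Cd *m qd w = Lq *m psi x u.

Definition volt_within x u (k : 'I_nb) : Prop :=
  v_min N k 0 <= volt x u k 0 <= v_max N k 0.

Definition phi_within x (l : 'I_nl) : Prop :=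
  phi_min N l 0 <= phi x l 0 <= phi_max N l 0.

Definition within_limits x u (qg : 'cV[R]_ng) : Prop :=
  [/\ forall i, pg_min N i 0 <= pgen x u i 0 <= pg_max N i 0,
      forall i, qg_min N i 0 <= qg i 0 <= qg_max N i 0,
      forall k, volt_within x u k,
      forall l, phi_within x l
    & forall l,
        (Lpf *m psi x u) l 0 ^+ 2 + (Lqf *m psi x u) l 0 ^+ 2
          <= s_max N l 0 ^+ 2 /\
        (Lpt *m psi x u) l 0 ^+ 2 + (Lqt *m psi x u) l 0 ^+ 2
          <= s_max N l 0 ^+ 2].

Definition robustly_feasible (W : set 'cV[R]_(nd + nd)) (u : 'cV[R]_(ng + ng)) :
    Prop :=
  forall w, W w -> exists x, exists qg,
    [/\ power_flow x u w, pv_reactive_balance x u w qg & within_limits x u qg].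

Definition uncertainty_set (w0 : 'cV[R]_(nd + nd)) (Sigma : 'M[R]_(nd + nd))
    (gamma : R) : set 'cV[R]_(nd + nd) :=
  [set w | ((w - w0)^T *m invmx Sigma *m (w - w0)) 0 0 <= gamma ^+ 2].

Section Linearization.
Variables (x0 : 'cV[R]_(nb + npq)) (u0 : 'cV[R]_(ng + ng)).

(* [jacobian] is for functions of row vectors, with values row vectors, and
   is the transpose of the matrix of partial derivatives. *)
Definition Jpsi : 'M[R]_(ng + nl + nl + nb, nb + npq) :=
  (jacobian (fun y : 'rV[R]_(nb + npq) => (psi y^T u0)^T) x0^T)^T.

Definition Jf : 'M[R]_(nb + npq) := M_mx *m Jpsi.

Definition K_mx : 'M[R]_(nl + npq + 1, ng + nl + nl + nb) :=
  - (A_mx *m invmx Jf *m M_mx).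

Definition residual x u : 'cV[R]_(ng + nl + nl + nb) := psi x u - Jpsi *m x.

Definition line_args x u (l : 'I_nl) : R * R * R :=
  (volt x u (from_bus N l) 0, volt x u (to_bus N l) 0, phi x l 0).

Definition line_within x u (l : 'I_nl) : Prop :=
  [/\ volt_within x u (from_bus N l), volt_within x u (to_bus N l)
    & phi_within x l].

Definition convex_envelopes (F : envelopes R nb nl ng) : Prop :=
  [/\ forall i,
        [/\ concave_on_space (E := R^o) (gp_lo F i),
            convex_on_space (E := R^o) (gp_hi F i),
            concave_on_space (E := (R^o * R^o)%type) (psip_lo F i)
          & convex_on_space (E := (R^o * R^o)%type) (psip_hi F i)],
      forall l,
        [/\ concave_on_space (E := (R^o * R^o * R^o)%type) (gcos_lo F l),
            convex_on_space (E := (R^o * R^o * R^o)%type) (gcos_hi F l),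
            concave_on_space (E := (R^o * R^o * R^o)%type) (gsin_lo F l)
          & convex_on_space (E := (R^o * R^o * R^o)%type) (gsin_hi F l)],
      forall l,
        [/\ concave_on_space (E := (R^o * R^o * R^o)%type) (psicos_lo F l),
            convex_on_space (E := (R^o * R^o * R^o)%type) (psicos_hi F l),
            concave_on_space (E := (R^o * R^o * R^o)%type) (psisin_lo F l)
          & convex_on_space (E := (R^o * R^o * R^o)%type) (psisin_hi F l)]
    & forall k,
        [/\ concave_on_space (E := R^o) (gv_lo F k),
            convex_on_space (E := R^o) (gv_hi F k),
            concave_on_space (E := R^o) (psiquad_lo F k)
          & convex_on_space (E := R^o) (psiquad_hi F k)]].

(* Each component is bounded on its own arguments: only the limits on those
   arguments are assumed, and, as (x, u) varies, they take all values within
   these limits. *)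
Definition enclosing_envelopes (F : envelopes R nb nl ng) : Prop :=
  forall x u, is_dispatch u ->
  let g := residual x u in
  let ps := psi x u in
  [/\ forall i,
        gp_lo F i (pgref u i 0) <= p_blk g i 0 <= gp_hi F i (pgref u i 0) /\
        psip_lo F i (pgref u i 0, Delta x) <= p_blk ps i 0
          <= psip_hi F i (pgref u i 0, Delta x),
      forall l, line_within x u l ->
        let a := line_args x u l in
        [/\ gcos_lo F l a <= cos_blk g l 0 <= gcos_hi F l a,
            gsin_lo F l a <= sin_blk g l 0 <= gsin_hi F l a,
            psicos_lo F l a <= cos_blk ps l 0 <= psicos_hi F l a
          & psisin_lo F l a <= sin_blk ps l 0 <= psisin_hi F l a]
    & forall k, volt_within x u k ->
        let v := volt x u k 0 in
        gv_lo F k v <= v_blk g k 0 <= gv_hi F k v /\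
        psiquad_lo F k v <= v_blk ps k 0 <= psiquad_hi F k v].

End Linearization.

Section Certificate.
Variable u : 'cV[R]_(ng + ng).

(* At a PV bus both bounds are the setpoint. *)
Definition volt_bounds (zl zu : 'cV[R]_(nl + npq + 1)) (k : 'I_nb) : seq R :=
  [:: bus_volt (vpq_of zl) (vgen u) k; bus_volt (vpq_of zu) (vgen u) k].

Definition phi_bounds (zl zu : 'cV[R]_(nl + npq + 1)) (l : 'I_nl) : seq R :=
  [:: ang_of zl l 0; ang_of zu l 0].

Definition residual_bounds (F : envelopes R nb nl ng)
    (zl zu : 'cV[R]_(nl + npq + 1)) (gl gu : 'cV[R]_(ng + nl + nl + nb)) :
    Prop :=
  [/\ forall i,
        p_blk gl i 0 <= gp_lo F i (pgref u i 0) /\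
        gp_hi F i (pgref u i 0) <= p_blk gu i 0,
      forall l vf vt ph,
        vf \in volt_bounds zl zu (from_bus N l) ->
        vt \in volt_bounds zl zu (to_bus N l) ->
        ph \in phi_bounds zl zu l ->
        [/\ cos_blk gl l 0 <= gcos_lo F l (vf, vt, ph),
            gcos_hi F l (vf, vt, ph) <= cos_blk gu l 0,
            sin_blk gl l 0 <= gsin_lo F l (vf, vt, ph)
          & gsin_hi F l (vf, vt, ph) <= sin_blk gu l 0]
    & forall k v, v \in volt_bounds zl zu k ->
        v_blk gl k 0 <= gv_lo F k v /\ gv_hi F k v <= v_blk gu k 0].

Definition basis_bounds (F : envelopes R nb nl ng)
    (zl zu : 'cV[R]_(nl + npq + 1)) (psil psiu : 'cV[R]_(ng + nl + nl + nb)) :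
    Prop :=
  [/\ forall i D, D \in [:: Delta_of zl; Delta_of zu] ->
        p_blk psil i 0 <= psip_lo F i (pgref u i 0, D) /\
        psip_hi F i (pgref u i 0, D) <= p_blk psiu i 0,
      forall l vf vt ph,
        vf \in volt_bounds zl zu (from_bus N l) ->
        vt \in volt_bounds zl zu (to_bus N l) ->
        ph \in phi_bounds zl zu l ->
        [/\ cos_blk psil l 0 <= psicos_lo F l (vf, vt, ph),
            psicos_hi F l (vf, vt, ph) <= cos_blk psiu l 0,
            sin_blk psil l 0 <= psisin_lo F l (vf, vt, ph)
          & psisin_hi F l (vf, vt, ph) <= sin_blk psiu l 0]
    & forall k v, v \in volt_bounds zl zu k ->
        v_blk psil k 0 <= psiquad_lo F k v /\
        psiquad_hi F k v <= v_blk psiu k 0].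

(* [Sh] stands for the Cholesky factor of Sigma. *)
Definition xi_center x0 u0 (w0 : 'cV[R]_(nd + nd)) i : R :=
  - (row i A_mx *m invmx (Jf x0 u0) *m R_mx *m w0) 0 0.
Definition xi_radius x0 u0 (Sh : 'M[R]_(nd + nd)) i : R :=
  norm2 (row i A_mx *m invmx (Jf x0 u0) *m R_mx *m Sh).
Definition xi_hi x0 u0 w0 Sh (gamma : R) : 'cV[R]_(nl + npq + 1) :=
  \col_i (xi_center x0 u0 w0 i + gamma * xi_radius x0 u0 Sh i).
Definition xi_lo x0 u0 w0 Sh (gamma : R) : 'cV[R]_(nl + npq + 1) :=
  \col_i (xi_center x0 u0 w0 i - gamma * xi_radius x0 u0 Sh i).

Definition self_mapping x0 u0 w0 Sh gamma
    (zl zu : 'cV[R]_(nl + npq + 1)) (gl gu : 'cV[R]_(ng + nl + nl + nb)) :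
    Prop :=
  let K := K_mx x0 u0 in
  cvle (posmx K *m gu + negmx K *m gl + xi_hi x0 u0 w0 Sh gamma) zu /\
  cvle zl (posmx K *m gl + negmx K *m gu + xi_lo x0 u0 w0 Sh gamma).

Definition operational_bounds (zl zu : 'cV[R]_(nl + npq + 1))
    (qgl qgu : 'cV[R]_ng) (spf sqf spt sqt : 'cV[R]_nl) : Prop :=
  [/\ forall i,
        [/\ pg_min N i 0 <= pgref u i 0 + alpha N i 0 * Delta_of zl,
            pgref u i 0 + alpha N i 0 * Delta_of zu <= pg_max N i 0,
            qg_min N i 0 <= qgl i 0, qgu i 0 <= qg_max N i 0
          & v_min N (gen_bus N i) 0 <= vgen u i 0 <= v_max N (gen_bus N i) 0],
      forall i,
        v_min N (pq_bus i) 0 <= vpq_of zl i 0 /\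
        vpq_of zu i 0 <= v_max N (pq_bus i) 0
    & forall l,
        [/\ phi_min N l 0 <= ang_of zl l 0, ang_of zu l 0 <= phi_max N l 0,
            spf l 0 ^+ 2 + sqf l 0 ^+ 2 <= s_max N l 0 ^+ 2
          & spt l 0 ^+ 2 + sqt l 0 ^+ 2 <= s_max N l 0 ^+ 2]].

Definition zeta_center (w0 : 'cV[R]_(nd + nd)) (i : 'I_npv) : R :=
  (row i (pv_rows Cd) *m qd w0) 0 0.
Definition zeta_radius (Sh : 'M[R]_(nd + nd)) (i : 'I_npv) : R :=
  norm2 (row i (pv_rows Cd) *m (dsubmx Sh : 'M[R]_(nd, nd + nd))).
Definition zeta_hi w0 Sh (gamma : R) : 'cV[R]_npv :=
  \col_i (zeta_center w0 i + gamma * zeta_radius Sh i).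
Definition zeta_lo w0 Sh (gamma : R) : 'cV[R]_npv :=
  \col_i (zeta_center w0 i - gamma * zeta_radius Sh i).

Definition reactive_bounds w0 Sh gamma (psil psiu : 'cV[R]_(ng + nl + nl + nb))
    (qgl qgu : 'cV[R]_ng) : Prop :=
  cvle (posmx Lq *m psiu + negmx Lq *m psil + zeta_hi w0 Sh gamma)
    (pv_rows Cg *m qgu) /\
  cvle (pv_rows Cg *m qgl)
    (negmx Lq *m psiu + posmx Lq *m psil + zeta_lo w0 Sh gamma).

Definition flow_bound (L : 'M[R]_(nl, ng + nl + nl + nb))
    (psil psiu : 'cV[R]_(ng + nl + nl + nb)) (s : 'cV[R]_nl) : Prop :=
  cvle (posmx L *m psiu + negmx L *m psil) s /\
  cvle (- (negmx L *m psiu) - posmx L *m psil) s.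

Definition line_flow_bounds (psil psiu : 'cV[R]_(ng + nl + nl + nb))
    (spf sqf spt sqt : 'cV[R]_nl) : Prop :=
  [/\ flow_bound Lpf psil psiu spf, flow_bound Lqf psil psiu sqf,
      flow_bound Lpt psil psiu spt & flow_bound Lqt psil psiu sqt].

End Certificate.
End PowerFlow.

(* Main.v *)
(* For a load w, put X g = - Jf^-1 (M g + R w). If g = residual (X g), then X g
   solves the power flow equations, and A (X g) = K g - A Jf^-1 R w. Condition
   (3) says that X maps the box [gl, gu] into {x | zl <= A x <= zu}, and
   condition (1), with the convexity of the envelopes, that the residual maps
   this set back into [gl, gu]. Brouwer's theorem on the box [gl, gu] gives the
   fixed point; unlike the polytope {x | zl <= A x <= zu}, this box is easily
   seen to be nonempty. As qgl <= qgu is not assumed, the reactive power at a PV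
   bus is split by interpolation between qg_min and qg_max.

   Brouwer's theorem follows from Kuhn's lemma on 0/1-labellings of a cubical
   grid. The latter is a discrete Stokes argument: with cup products of cochains
   modulo 2, the sum over the grid of d l_1 ... d l_n telescopes to the same
   sum for l_2, ..., l_n on the face where the first coordinate is maximal, so
   that it is 1 by induction on n; where a term of the sum is nonzero, every
   label l_i takes both values on the cell. *)

Require Import Defs.
From HB Require Import structures.
From mathcomp Require Import all_boot all_order all_algebra.
From mathcomp Require Import boolp classical_sets reals topology normedtype.
From mathcomp Require Import derive trigo convex.
From mathcomp Require Import interval_inference.
From mathcomp Require Import zify ring lra.

Set Implicit Arguments.
Unset Strict Implicit.
Unset Printing Implicit Defensive.

Import Order.TTheory GRing.Theory Num.Theory.
Import numFieldNormedType.Exports.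

Local Open Scope ring_scope.

(** * Kuhn's lemma *)

Section KuhnLemma.
Variable n : nat.
Local Notation point := {ffun 'I_n -> nat}.
Implicit Types (a b c : 'I_n) (y z : point) (f g : point -> 'F_2).
Implicit Types (r : seq 'I_n) (I J : {set 'I_n}).

Definition incr_coord a z : point := [ffun i => (z i + (i == a))%N].
Definition set_coord b j z : point := [ffun i => if i == b then j else z i].
Definition fdiff a f z : 'F_2 := f (incr_coord a z) - f z.

Lemma incr_coordC a b z :
  incr_coord a (incr_coord b z) = incr_coord b (incr_coord a z).
Proof. by apply/ffunP => i; rewrite !ffunE addnAC. Qed.

Lemma set_coord_incr a b j z : a != b ->
  set_coord b j (incr_coord a z) = incr_coord a (set_coord b j z).
Proof.
by move=> ab; apply/ffunP => i; rewrite !ffunE; case: eqP => // ->;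
  rewrite eq_sym (negPf ab) addn0.
Qed.

Lemma incr_set_coord b j z :
  incr_coord b (set_coord b j z) = set_coord b j.+1 z.
Proof.
by apply/ffunP => i; rewrite !ffunE; case: eqP; rewrite ?addn0 ?addn1.
Qed.

Lemma fdiffC a b f z : fdiff a (fdiff b f) z = fdiff b (fdiff a f) z.
Proof. by rewrite /fdiff incr_coordC; ring. Qed.

(** The terms at [(a, c)] and [(c, a)] are equal, hence cancel in characteristic 2. *)
Lemma sym_sum_offdiag J (G : 'I_n -> 'I_n -> 'F_2) :
  (forall a c, G a c = G c a) -> \sum_(a in J) \sum_(c in J :\ a) G a c = 0.
Proof.
move=> GC.
have split_lt a : \sum_(c in J :\ a) G a c =
    \sum_(c in J | (c < a)%N) G a c + \sum_(c in J | (a < c)%N) G a c.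
  rewrite (bigID (fun c : 'I_n => c < a)%N) /=; congr (_ + _);
    apply: eq_bigl => c;
    rewrite !inE -(inj_eq val_inj) /=; case: (c \in J); rewrite ?andbF //=; lia.
rewrite (eq_bigr _ (fun a _ => split_lt a)) big_split /=.
rewrite [X in _ + X](exchange_big_dep (mem J)) /=; last by move=> ? ? _ /andP[].
have -> : \sum_(j in J) \sum_(i in J | (j \in J) && (i < j)%N) G i j =
          \sum_(a in J) \sum_(c in J | (c < a)%N) G a c.
  by apply: eq_bigr => a aJ; apply: eq_big => [c|c _]; rewrite ?aJ // GC.
by rewrite addrr_pchar2 // pchar_Fp.
Qed.

Variable label : 'I_n -> point -> bool.

(* The coefficient on the axes [I] of the cup product modulo 2 of the
   coboundaries of the labels in [r]. As the product c of the tail of [r] is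
   closed, d l * c is written as the coboundary d (l * c). *)
Fixpoint cup r I z : 'F_2 :=
  if r is b :: r' then
    \sum_(a in I) fdiff a (fun y => (label b y)%:R * cup r' (I :\ a) y) z
  else 1.

(** This is [d d = 0]: each summand is itself a coboundary, differences along two axes commute, and
    the second differences cancel in pairs. For empty [r] the cochain is constant. *)
Lemma cup_closed r J z : \sum_(a in J) fdiff a (cup r (J :\ a)) z = 0.
Proof.
case: r => [|b r] /=; first by apply: big1 => a _; rewrite /fdiff subrr.
pose G a c :=
  fdiff a (fdiff c (fun y => (label b y)%:R * cup r (J :\ a :\ c) y)) z.
rewrite -[RHS](@sym_sum_offdiag J G) => [|a c]; last first.
  by rewrite /G fdiffC [J :\ c :\ a]finset.setDDl finset.setUC -finset.setDDl.
by apply: eq_bigr => a _; rewrite /fdiff -sumrB.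
Qed.

(** Discrete Leibniz rule: the difference of a product leaves [label b z] times the coboundary of
    the tail, which vanishes by closedness. What remains is the usual cup product, with the tail
    evaluated on the back face. *)
Lemma cup_cons b r I z :
  cup (b :: r) I z =
  \sum_(a in I) fdiff a (fun y => (label b y)%:R) z *
                  cup r (I :\ a) (incr_coord a z).
Proof.
have closed : (label b z)%:R * \sum_(a in I) fdiff a (cup r (I :\ a)) z = 0.
  by rewrite cup_closed mulr0.
rewrite -[RHS]addr0 -[X in _ + X]closed mulr_sumr -big_split /=.
by apply: eq_bigr => a _; rewrite /fdiff; ring.
Qed.

(** The vertices of the grid face with lowest corner [z] and directions [I]. *)
Definition in_cell I z y := forall i, (z i <= y i <= z i + (i \in I))%N.

(** A nonzero product has a nonzero term in the expansion of [cup_cons]: the head label changes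
    along the edge from [z] in direction [a], and induction applies to the tail on the opposite
    face, which lies in the same cell. *)
Lemma cup_neq0 r I z b : cup r I z != 0 -> b \in r ->
  exists y y', [/\ in_cell I z y, in_cell I z y' & label b y != label b y'].
Proof.
elim: r I z => // b' r IH I z; rewrite cup_cons => /eqP nz.
pose good a := [&& a \in I, fdiff a (fun y => (label b' y)%:R) z != 0 &
  cup r (I :\ a) (incr_coord a z) != 0].
case: (pickP good) => [a /and3P[aI dnz cnz]|none]; last first.
  case: nz; apply: big1 => a aI; have /negbT := none a.
  by rewrite /good aI /= negb_and !negbK => /orP[] /eqP ->;
    rewrite ?mul0r ?mulr0.
rewrite inE => /predU1P[->|br].
  exists z, (incr_coord a z); split=> [i|i|].
  - by rewrite leqnn leq_addr.
  - by rewrite ffunE leq_addr leq_add2l; case: eqP => [->|]; rewrite ?aI.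
  - by apply: contra dnz => /eqP e; rewrite /fdiff e subrr.
have [y [y' [cy cy' yy']]] := IH _ _ cnz br.
have sub u : in_cell (I :\ a) (incr_coord a z) u -> in_cell I z u.
  move=> cu i; have := cu i; rewrite ffunE !inE;
    case: (eqVneq i a) => [->|_] /=; rewrite ?aI; try case: (i \in I) => /=;
    lia.
by exists y, y'; split=> //; exact: sub.
Qed.

(** Summing axis by axis along a list, rather than over all grid points at once, allows one axis to
    be telescoped while the others stay untouched. *)
Fixpoint boxsum k r f : point -> 'F_2 :=
  if r is b :: r' then
    boxsum k r' (fun z => \sum_(j < k) f (set_coord b j z))
  else f.

Lemma eq_boxsum k r f g z :
  (forall y, (forall i, i \notin r -> y i = z i) -> f y = g y) ->
  boxsum k r f z = boxsum k r g z.
Proof.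
elim: r f g => [|b r IH] f g fg /=; first exact: fg.
apply: IH => y yz; apply: eq_bigr => j _; apply: fg => i.
by rewrite inE ffunE negb_or => /andP[/negPf -> /yz].
Qed.

Lemma boxsum_sum k r J (h : 'I_n -> point -> 'F_2) z :
  boxsum k r (fun y => \sum_(a in J) h a y) z =
    \sum_(a in J) boxsum k r (h a) z.
Proof.
elim: r h => [|b r IH] h //=; rewrite -IH; apply: eq_boxsum => y _.
exact: exchange_big.
Qed.

Lemma boxsum0 k r z : boxsum k r (fun=> 0) z = 0.
Proof.
elim: r => //= b r IH; rewrite -[RHS]IH.
by apply: eq_boxsum => y _; rewrite big1.
Qed.

Lemma sum_fdiff k a f z :
  \sum_(j < k) fdiff a f (set_coord a j z) =
    f (set_coord a k z) - f (set_coord a 0%N z).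
Proof.
rewrite -(telescope_sumr (fun j => f (set_coord a j z))) // big_mkord.
by apply: eq_bigr => j _; rewrite /fdiff incr_set_coord.
Qed.

(** The sum telescopes along axis [a] to values of [f] on the two faces where it vanishes. *)
Lemma boxsum_fdiff k r a f z : a \in r ->
  (forall y, y a = 0%N \/ y a = k -> f y = 0) -> boxsum k r (fdiff a f) z = 0.
Proof.
elim: r f => // b r IH f /[!inE] /predU1P[-> f0|ar f0] /=.
  rewrite -[RHS](boxsum0 k r z); apply: eq_boxsum => y _.
  by rewrite sum_fdiff !f0 ?subr0 // ffunE eqxx; [left|right].
have [<-|ab] := eqVneq a b.
  rewrite -[RHS](boxsum0 k r z); apply: eq_boxsum => y _.
  by rewrite sum_fdiff !f0 ?subr0 // ffunE eqxx; [left|right].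
rewrite -[RHS](IH (fun y => \sum_(j < k) f (set_coord b j y))) //; last first.
  by move=> y ya; apply: big1 => j _; rewrite f0 // ffunE (negPf ab).
apply: eq_boxsum => y _; rewrite /fdiff -sumrB.
by apply: eq_bigr => j _; rewrite set_coord_incr.
Qed.

Lemma boxsum_neq0 k r f z : boxsum k r f z != 0 ->
  exists y, (forall i, i \in r -> (y i < k)%N) /\ f y != 0.
Proof.
elim: r f => [|b r IH] f /=; first by exists z.
move=> /IH[y [yk /eqP nz]].
case: (pickP (fun j : 'I_k => f (set_coord b j y) != 0)) => [j fj|none];
  last first.
  by case: nz; apply: big1 => j _; apply/eqP/negbFE/none.
exists (set_coord b j y); split=> // i; rewrite inE ffunE; case: eqP => //= _;
  exact: yk.
Qed.

Variable k : nat.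
Hypothesis label0 : forall b z, z b = 0%N -> label b z = false.
Hypothesis labelk : forall b z, z b = k -> label b z = true.

Lemma boxsum_set_coord r b j f z : b \notin r ->
  boxsum k r (fun y => f (set_coord b j y)) z = boxsum k r f (set_coord b j z).
Proof.
elim: r f => //= a r IH f; rewrite inE negb_or => /andP[ba br].
rewrite -IH //; apply: eq_boxsum => y _; apply: eq_bigr => i _; congr f.
by apply/ffunP => c; rewrite !ffunE; case: eqP => // ->; rewrite (negPf ba).
Qed.

(** Axes [a] of the tail contribute nothing: on the faces where coordinate [a] is 0 or [k], label
    [a] is constant on cells that do not extend along [a], so the tail product is 0 there by
    [cup_neq0]. Along the axis [b] of the head the sum telescopes, and the label is 1 at one end and
    0 at the other, which leaves the sum for the tail on the face at [k]. *)
Lemma boxsum_cup r z : uniq r -> boxsum k r (cup r [set i in r]) z = 1.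
Proof.
elim: r z => // b r IH z; rewrite [uniq _]/= => /andP[br ur].
rewrite boxsum_sum (bigD1 b) ?inE ?eqxx //= big1 ?addr0 => [|a]; last first.
  rewrite !inE => /andP[/predU1P[->|ar] ab]; first by rewrite eqxx in ab.
  apply: (@boxsum_fdiff k (b :: r) a
    (fun y => (label b y)%:R * cup r ([set i in b :: r] :\ a) y)) => [|y ya];
      first by rewrite inE ar orbT.
  apply/eqP; rewrite mulf_eq0; apply/orP; right; apply/negPn/negP => nz.
  have [y1 [y2 [c1 c2]]] := cup_neq0 nz ar.
  have same u : in_cell ([set i in b :: r] :\ a) y u -> u a = y a.
    by move=> /(_ a); rewrite !inE eqxx /=; lia.
  by case: ya => ya; [rewrite !label0 | rewrite !labelk]; rewrite ?same.
rewrite -[RHS](IH (set_coord b k z) ur) -boxsum_set_coord //.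
apply: eq_boxsum => y _; rewrite sum_fdiff.
rewrite (@label0 b (set_coord b 0%N y)) ?(@labelk b (set_coord b k y)) ?ffunE
  ?eqxx //.
rewrite mul1r mul0r subr0; congr (cup r _ _).
by apply/setP => i; rewrite !inE; case: eqP => /= [->|_] //; rewrite (negPf br).
Qed.

Lemma kuhn_lemma : exists z, (forall i, (z i < k)%N) /\
  forall b, exists y y', [/\ forall i, (z i <= y i <= (z i).+1)%N,
    forall i, (z i <= y' i <= (z i).+1)%N,
    label b y = false & label b y' = true].
Proof.
have : boxsum k (enum 'I_n) (cup (enum 'I_n) [set i in enum 'I_n])
    [ffun=> 0%N] != 0.
  by rewrite boxsum_cup ?enum_uniq ?oner_neq0.
case/boxsum_neq0 => z [zk nz]; exists z; split=> [i|b];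
  first by rewrite zk ?mem_enum.
have [y [y' [cy cy']]] := cup_neq0 nz (mem_enum 'I_n b).
have cell u : in_cell [set i in enum 'I_n] z u ->
    forall i, (z i <= u i <= (z i).+1)%N.
  by move=> cu i; have := cu i; rewrite inE mem_enum addn1.
move/cell in cy; move/cell in cy'.
case ey: (label b y); case ey': (label b y') => // _; first by exists y', y.
by exists y, y'.
Qed.
End KuhnLemma.

(** * Brouwer's fixed point theorem *)

Section Brouwer.
Local Open Scope classical_set_scope.
Variables (R : realType) (n : nat) (lo hi : 'rV[R]_n).
Hypothesis lo_hi : forall i, lo 0 i <= hi 0 i.

Definition in_box (x : 'rV[R]_n) := forall i, lo 0 i <= x 0 i <= hi 0 i.

Definition lattice_pt k (z : {ffun 'I_n -> nat}) : 'rV[R]_n :=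
  \row_i (lo 0 i + (z i)%:R / k%:R * (hi 0 i - lo 0 i)).

Lemma lattice_pt_in_box k (z : {ffun 'I_n -> nat}) : (0 < k)%N ->
  (forall i, (z i <= k)%N) -> in_box (lattice_pt k z).
Proof.
move=> k0 zk i; rewrite mxE.
have : 0 <= (z i)%:R / k%:R :> R by rewrite divr_ge0.
have : (z i)%:R / k%:R <= 1 :> R by rewrite ler_pdivrMr ?ltr0n // mul1r ler_nat.
move: (_ / _) => t t1 t0; have := lo_hi i; nra.
Qed.

Variable f : 'rV[R]_n -> 'rV[R]_n.
Hypothesis f_box : forall x, in_box x -> in_box (f x).

Lemma lattice_sign_change k : (0 < k)%N -> exists x, in_box x /\
  forall b, exists y y', [/\ in_box y, in_box y',
    forall i, `|x 0 i - y 0 i| <= (hi 0 i - lo 0 i) / k%:R,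
    forall i, `|x 0 i - y' 0 i| <= (hi 0 i - lo 0 i) / k%:R &
    y 0 b <= f y 0 b /\ f y' 0 b <= y' 0 b].
Proof.
move=> k0.
(* The label says that [f] does not increase coordinate [b]. The clauses for 0 and [k] force the
   values required on the faces; they agree with the sign of the displacement there because [f] maps
   the box into itself. *)
pose lab b (z : {ffun 'I_n -> nat}) := (z b != 0%N) &&
  ((z b == k) || (f (lattice_pt k z) 0 b <= lattice_pt k z 0 b)).
have [||z [zk zl]] := @kuhn_lemma n lab k.
- by move=> b z zb; rewrite /lab zb eqxx.
- by move=> b z zb; rewrite /lab zb eqxx -lt0n k0.
have near (y : {ffun 'I_n -> nat}) i : (z i <= y i <= (z i).+1)%N ->
    `|lattice_pt k z 0 i - lattice_pt k y 0 i| <= (hi 0 i - lo 0 i) / k%:R.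
  move=> zy; rewrite !mxE opprD addrACA subrr add0r -mulrBl -mulrBl
    [leRHS]mulrC.
  rewrite normrM [X in _ * X]ger0_norm ?subr_ge0 //.
  rewrite ler_wpM2r ?subr_ge0 // normrM [X in _ * X]ger0_norm ?invr_ge0 //.
  rewrite -[leRHS]mul1r ler_wpM2r ?invr_ge0 //.
  have /orP[/eqP ->|/eqP ->] : (y i == z i) || (y i == (z i).+1) by lia.
    by rewrite subrr normr0 ler01.
  by rewrite -natr1 opprD addrA subrr add0r normrN1.
have box (y : {ffun 'I_n -> nat}) : (forall i, (z i <= y i <= (z i).+1)%N) ->
    in_box (lattice_pt k y).
  by move=> zy; apply: lattice_pt_in_box => // i; have := zy i; have := zk i;
    lia.
exists (lattice_pt k z); split=> [|b].
  by apply: box => i; rewrite leqnn leqnSn.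
have [y [y' [zy zy' ly ly']]] := zl b.
exists (lattice_pt k y), (lattice_pt k y'); split=> [||i|i|];
  [exact: box|exact: box|exact: near|exact: near|].
split.
  move: ly; rewrite /lab; case: eqP => [yb _|_ /= /negbT].
    by have /andP[+ _] := f_box (box _ zy) b; rewrite mxE yb mul0r mul0r addr0.
  by rewrite negb_or => /andP[_]; rewrite -ltNge => /ltW.
move: ly'; rewrite /lab => /andP[_] /orP[/eqP yb|//].
have /andP[_] := f_box (box _ zy') b.
by rewrite [X in _ -> _ <= X]mxE yb divff ?pnatr_eq0 -?lt0n // mul1r addrC
  subrK.
Qed.

Hypothesis f_cont : forall i, continuous (fun x => f x 0 i).

(** By compactness the corners [u k] of ever finer cells have a cluster point [p]. Near [p] there
    are points where coordinate [b] of [f y - y] is nonnegative and points where it is nonpositive,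
    so by continuity it vanishes at [p]. *)
Theorem brouwer_box : exists x, in_box x /\ f x = x.
Proof.
have /choice[u uP] (k : nat) := @lattice_sign_change k.+1 isT.
have box_compact :
    compact [set v : 'rV[R]_n | forall i, `[lo 0 i, hi 0 i]%classic (v 0 i)].
  by apply: (@rV_compact R n (fun i => `[lo 0 i, hi 0 i]%classic)) => i;
    exact: segment_compact.
have [|p [pbox pcl]] := box_compact (u @ \oo) _.
  by exists 0%N => // k _ i /=; rewrite in_itv /=; exact: (uP k).1.
exists p; split; first by move=> i; have := pbox i; rewrite /= in_itv.
pose C := \sum_i (hi 0 i - lo 0 i).
have leC i : hi 0 i - lo 0 i <= C.
  by rewrite /C (bigD1 i) //= lerDl sumr_ge0 // => j _; rewrite subr_ge0.
have approx (P : set 'rV[R]_n) : nbhs p P -> exists k, forall y : 'rV[R]_n,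
    (forall i, `|u k 0 i - y 0 i| <= (hi 0 i - lo 0 i) / k.+1%:R) -> P y.
  move=> /nbhs_ballP[e /= e0 pP]; have e2 : 0 < e / 2 by rewrite divr_gt0.
  (* This choice makes the mesh [C / k.+1] smaller than [e / 2] for all [k >= K]; the other half of
     [e] covers the distance from [p] to [u k]. *)
  pose K := Num.truncn (C / (e / 2)).
  have [|_ [[k /= Kk <-] [_ pu]]] :=
      pcl (u @` [set k | (K <= k)%N]) (ball p (e / 2)) _ (nbhsx_ballx _ _ e2).
    by exists K => // k Kk; exists k.
  exists k => y uy; apply: pP; split=> // i j; rewrite ord1 [e]splitr.
  apply: ball_triangle (pu 0 j) _; apply: le_lt_trans (uy j) _.
  rewrite ltr_pdivrMr ?ltr0n //; apply: le_lt_trans (leC j) _.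
  rewrite mulrC -ltr_pdivrMr //; apply: lt_le_trans (truncnS_gt _) _.
  by rewrite ler_nat ltnS.
apply/rowP => b; apply/eqP; rewrite -subr_eq0.
have gap_cont : {for p, continuous (fun x => f x 0 b - x 0 b)}.
  by apply: continuousB; [exact: f_cont|exact: coord_continuous].
have [gap|gap|//] := ltgtP (f p 0 b - p 0 b) 0.
  have [k kP] := approx _ (cvgr_lt _ gap_cont _ gap).
  have [y [y' [_ _ /kP/= gapy _ [le_y _]]]] := (uP k).2 b.
  by move: gapy; rewrite subr_lt0 ltNge le_y.
have [k kP] := approx _ (cvgr_gt _ gap_cont _ gap).
have [y [y' [_ _ _ /kP/= gapy [_ le_y]]]] := (uP k).2 b.
by move: gapy; rewrite subr_gt0 ltNge le_y.
Qed.
End Brouwer.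

(** * Linear algebra and convexity *)

Section Generic.
Context {R : realType}.

Lemma cvle_colP m n (a b : 'cV[R]_(m + n)) :
  cvle a b <-> cvle (usubmx a) (usubmx b) /\ cvle (dsubmx a) (dsubmx b).
Proof.
split=> [ab|[abu abd] i]; first by split=> i; rewrite !mxE.
by case: (split_ordP i) => j ->; [have := abu j | have := abd j]; rewrite !mxE.
Qed.

Lemma castmx_mull m n n' p (e : n = n') (B : 'M[R]_(m, n)) (x : 'M[R]_(n', p)) :
  castmx (erefl, e) B *m x = B *m castmx (esym e, erefl) x.
Proof. by case: _ / e x => x; rewrite !castmx_id. Qed.

(** The sign of each coefficient decides which end of the interval bounds its term. *)
Lemma mulmx_bounds m n (X : 'M[R]_(m, n)) (a b y : 'cV[R]_n) :
  cvle a y -> cvle y b ->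
  cvle (posmx X *m a + negmx X *m b) (X *m y) /\
  cvle (X *m y) (posmx X *m b + negmx X *m a).
Proof.
move=> ay yb; split=> i; rewrite !mxE -big_split /= ler_sum // => j _;
  rewrite !mxE;
  have := ay j; have := yb j; case: (leP (X i j) 0) => ? ? ?; nra.
Qed.

Lemma cauchy_schwarz n (a b : 'I_n -> R) :
  (\sum_i a i * b i) ^+ 2 <= (\sum_i a i ^+ 2) * (\sum_i b i ^+ 2).
Proof.
(* Lagrange's identity *)
have : 0 <= \sum_i \sum_j (a i * b j - a j * b i) ^+ 2.
  by do 2!apply: sumr_ge0 => ? _; exact: sqr_ge0.
have -> : \sum_i \sum_j (a i * b j - a j * b i) ^+ 2 =
    ((\sum_i a i ^+ 2) * (\sum_i b i ^+ 2) +
     (\sum_i b i ^+ 2) * (\sum_i a i ^+ 2)) -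
    ((\sum_i a i * b i) * (\sum_i a i * b i)) *+ 2.
  rewrite !big_distrlr /= -sumrMnl -big_split -sumrB; apply: eq_bigr => i _.
  by rewrite -sumrMnl -big_split -sumrB; apply: eq_bigr => j _ /=; ring.
rewrite mulr2n expr2; lra.
Qed.

(** The factor is invertible, being triangular with positive diagonal. Substituting [d = Sh *m y]
    turns the ellipsoid into the ball of radius [gamma], and the Cauchy-Schwarz inequality applies
    to [r *m Sh] and [y]. *)
Lemma ler_norm_ellipsoid n (Sigma Sh : 'M[R]_n) (gamma : R) (r : 'rV[R]_n)
    (d : 'cV[R]_n) :
  cholesky_factor Sigma Sh -> 0 <= gamma ->
  (d^T *m invmx Sigma *m d) 0 0 <= gamma ^+ 2 ->
  `|(r *m d) 0 0| <= gamma * norm2 (r *m Sh).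
Proof.
move=> [trig diag ->] gamma0.
have Sh_unit : Sh \in unitmx.
  rewrite unitmxE unitfE det_trig //; apply/prodf_neq0 => i _; exact: lt0r_neq0.
have ShT_unit : Sh^T \in unitmx by rewrite unitmx_tr.
have [y ->] : exists y, d = Sh *m y by exists (invmx Sh *m d); rewrite mulKVmx.
have -> : invmx (Sh *m Sh^T) = invmx Sh^T *m invmx Sh.
  apply: (can_inj (mulKmx (_ : Sh *m Sh^T \in unitmx)));
    first by rewrite unitmx_mul Sh_unit.
  by rewrite mulmxV ?unitmx_mul ?Sh_unit // -mulmxA (mulmxA Sh^T) mulmxV //
    mul1mx mulmxV.
rewrite trmx_mul !mulmxA mulmxK // mulmxKV //.
move=> yg; rewrite -(ler_pXn2r (n := 2)) ?nnegrE ?mulr_ge0 ?sqrtr_ge0 //.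
rewrite real_normK ?num_real // exprMn sqr_sqrtr ?sumr_ge0 // => [|? _];
  last exact: sqr_ge0.
rewrite mxE mulrC; apply: le_trans (cauchy_schwarz _ _) _.
rewrite ler_wpM2l ?sumr_ge0 // => [? _|]; first exact: sqr_ge0.
apply: le_trans yg; rewrite mxE le_eqVlt; apply/orP; left; apply/eqP.
by apply: eq_bigr => j _; rewrite mxE expr2.
Qed.

Lemma segment_param (a b v : R) : a <= v <= b ->
  exists t, 0 <= t <= 1 /\ v = t * a + (1 - t) * b.
Proof.
move=> /andP[av vb]; have [ab|ab] := ltP a b; last by exists 1; lra.
exists ((b - v) / (b - a)); split; last by field; rewrite subr_eq0 gt_eqF.
by rewrite divr_ge0 ?subr_ge0 ?(ltW ab) //= ler_pdivrMr ?subr_gt0 // mul1r lerB.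
Qed.

Lemma convex_on_spaceP (E : lmodType R) (f : E -> R) : convex_on_space f ->
  forall a b t, 0 <= t <= 1 ->
  f (t *: a + (1 - t) *: b) <= t * f a + (1 - t) * f b.
Proof.
by move=> cf a b t /andP[t0 t1]; have := cf (Itv01 t0 t1) a b;
  rewrite !in_setT; exact.
Qed.

(** The affine path [h] serves to move a single argument of a function of several variables while
    the others are kept fixed. *)
Lemma convex_segment_le (E : lmodType R) (f : E -> R) (h : R -> E)
    (a b v B : R) :
  convex_on_space f ->
  (forall x y t, h (t * x + (1 - t) * y) = t *: h x + (1 - t) *: h y) ->
  a <= v <= b -> f (h a) <= B -> f (h b) <= B -> f (h v) <= B.
Proof.
move=> /convex_on_spaceP cf aff /segment_param[t [t01 ->]] fa fb; rewrite aff.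
by apply: le_trans (cf _ _ _ t01) _; move/andP: t01 => [? ?]; nra.
Qed.

Lemma affine_cst (x t : R) : x = t * x + (1 - t) * x.
Proof. by ring. Qed.

Lemma convex1_le (f : R -> R) (a b v B : R) :
  convex_on_space (E := R^o) f -> a <= v <= b ->
  (forall x, x \in [:: a; b] -> f x <= B) -> f v <= B.
Proof.
move=> cf avb fB; apply: (@convex_segment_le R^o f id a b) => //; apply: fB;
  by rewrite !inE eqxx ?orbT.
Qed.

Lemma convex2_le (f : R * R -> R) (p a b v B : R) :
  convex_on_space (E := (R^o * R^o)%type) f -> a <= v <= b ->
  (forall x, x \in [:: a; b] -> f (p, x) <= B) -> f (p, v) <= B.
Proof.
move=> cf avb fB.
apply: (@convex_segment_le (R^o * R^o)%type f (fun x => (p, x)) a b) => //.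
- by move=> x y t; congr pair; exact: affine_cst.
- by apply: fB; rewrite !inE eqxx.
- by apply: fB; rewrite !inE eqxx orbT.
Qed.

(** The arguments leave the vertices of the box one at a time: the third, then the second, then the
    first. *)
Lemma convex3_le (f : R * R * R -> R) (a1 b1 v1 a2 b2 v2 a3 b3 v3 B : R) :
  convex_on_space (E := (R^o * R^o * R^o)%type) f ->
  a1 <= v1 <= b1 -> a2 <= v2 <= b2 -> a3 <= v3 <= b3 ->
  (forall x y z, x \in [:: a1; b1] -> y \in [:: a2; b2] -> z \in [:: a3; b3] ->
    f (x, y, z) <= B) -> f (v1, v2, v3) <= B.
Proof.
move=> cf avb1 avb2 avb3 fB.
have step3 x y : x \in [:: a1; b1] -> y \in [:: a2; b2] -> f (x, y, v3) <= B.
  move=> xin yin.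
  apply: (@convex_segment_le (R^o * R^o * R^o)%type f
    (fun z => (x, y, z)) a3 b3) => //.
  - by move=> z z' t; congr (_, _, _); exact: affine_cst.
  - by apply: fB; rewrite // !inE eqxx.
  - by apply: fB; rewrite // !inE eqxx orbT.
have step2 x : x \in [:: a1; b1] -> f (x, v2, v3) <= B.
  move=> xin.
  apply: (@convex_segment_le (R^o * R^o * R^o)%type f
    (fun y => (x, y, v3)) a2 b2) => //.
  - by move=> z z' t; congr (_, _, _); exact: affine_cst.
  - by apply: step3; rewrite // !inE eqxx.
  - by apply: step3; rewrite // !inE eqxx orbT.
apply: (@convex_segment_le (R^o * R^o * R^o)%type f
  (fun x => (x, v2, v3)) a1 b1) => //.
- by move=> z z' t; congr (_, _, _); exact: affine_cst.
- by apply: step2; rewrite // !inE eqxx.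
- by apply: step2; rewrite // !inE eqxx orbT.
Qed.

Lemma sqr_le_sym (a s : R) : a <= s -> - s <= a -> a ^+ 2 <= s ^+ 2.
Proof. by move=> ? ?; nra. Qed.

End Generic.

(** * Concave lower bounds and componentwise comparison of block vectors *)

Section Concave.
Context {R : realType}.

Lemma concave1_ge (f : R -> R) (a b v B : R) :
  concave_on_space (E := R^o) f -> a <= v <= b ->
  (forall x, x \in [:: a; b] -> B <= f x) -> B <= f v.
Proof.
move=> cf avb fB; rewrite -lerN2.
by apply: (convex1_le cf avb) => x xab; rewrite lerN2 fB.
Qed.

Lemma concave2_ge (f : R * R -> R) (p a b v B : R) :
  concave_on_space (E := (R^o * R^o)%type) f -> a <= v <= b ->
  (forall x, x \in [:: a; b] -> B <= f (p, x)) -> B <= f (p, v).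
Proof.
move=> cf avb fB; rewrite -lerN2.
by apply: (convex2_le cf avb) => x xab; rewrite lerN2 fB.
Qed.

Lemma concave3_ge (f : R * R * R -> R) (a1 b1 v1 a2 b2 v2 a3 b3 v3 B : R) :
  concave_on_space (E := (R^o * R^o * R^o)%type) f ->
  a1 <= v1 <= b1 -> a2 <= v2 <= b2 -> a3 <= v3 <= b3 ->
  (forall x y z, x \in [:: a1; b1] -> y \in [:: a2; b2] -> z \in [:: a3; b3] ->
    B <= f (x, y, z)) -> B <= f (v1, v2, v3).
Proof.
move=> cf avb1 avb2 avb3 fB; rewrite -lerN2.
by apply: (convex3_le cf avb1 avb2 avb3) => x y z xab yab zab; rewrite lerN2 fB.
Qed.

Lemma cvle_blocks ng nl nb (a b : 'cV[R]_(ng + nl + nl + nb)) :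
  cvle (p_blk a) (p_blk b) -> cvle (cos_blk a) (cos_blk b) ->
  cvle (sin_blk a) (sin_blk b) -> cvle (v_blk a) (v_blk b) -> cvle a b.
Proof.
move=> ? ? ? ?; apply/cvle_colP; split=> //; apply/cvle_colP; split=> //.
exact/cvle_colP.
Qed.

Lemma cvle_state m n (a b : 'cV[R]_(m + n + 1)) : cvle a b ->
  [/\ cvle (ang_of a) (ang_of b), cvle (vpq_of a) (vpq_of b) &
      Delta_of a <= Delta_of b].
Proof. by move=> /cvle_colP[/cvle_colP[? ?] /(_ 0) ?]; split. Qed.

End Concave.

(** * Power flow *)

Section Continuity.
Local Open Scope classical_set_scope.
Context {R : realType} {T : topologicalType}.

Lemma continuous_mulmx m n (X : 'M[R]_(m, n)) (h : T -> 'cV[R]_n) :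
  (forall j, continuous (fun t => h t j 0)) ->
  forall i, continuous (fun t => (X *m h t) i 0).
Proof.
move=> ch i; under eq_fun do rewrite mxE; apply: continuous_big => [|j _ t];
  first exact: add_continuous.
by apply: continuousM; [exact: cvg_cst | exact: ch].
Qed.

Lemma continuous_addmx n (h k : T -> 'cV[R]_n) :
  (forall j, continuous (fun t => h t j 0)) ->
  (forall j, continuous (fun t => k t j 0)) ->
  forall j, continuous (fun t => (h t + k t) j 0).
Proof.
move=> ch ck j; rewrite (_ : (fun t => _) = fun t => h t j 0 + k t j 0).
  by move=> t; apply: cvgD; [exact: ch | exact: ck].
by apply/funext => t; rewrite mxE.
Qed.

Lemma continuous_oppmx n (h : T -> 'cV[R]_n) :
  (forall j, continuous (fun t => h t j 0)) ->
  forall j, continuous (fun t => (- h t) j 0).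
Proof.
move=> ch j; rewrite (_ : (fun t => _) = fun t => - h t j 0).
  by move=> t; apply: cvgN; exact: ch.
by apply/funext => t; rewrite mxE.
Qed.
End Continuity.

(** * Bus voltages, angle differences, and allocation of reactive power *)

Section Network.
Local Open Scope classical_set_scope.
Context {R : realType} {nb nl ng nd : nat} (N : grid R nb nl ng nd).

Lemma A_mxE (x : 'cV[R]_(nb + npq N)) :
  A_mx N *m x = col_mx (col_mx (phi x) (vpq_of (state_blocks x)))
                  (dsubmx (state_blocks x)).
Proof.
rewrite castmx_mull -/(state_blocks x).
rewrite -[X in block_mx _ _ _ _ *m X]vsubmxK -[X in col_mx X _]vsubmxK.
by rewrite !mul_block_col !mul0mx !mul1mx !addr0 !add0r.
Qed.

Lemma ang_of_A_mx x : ang_of (A_mx N *m x) = phi x.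
Proof. by rewrite A_mxE /ang_of !col_mxKu. Qed.

Lemma vpq_of_A_mx x : vpq_of (A_mx N *m x) = vpq_of (state_blocks x).
Proof. by rewrite A_mxE /vpq_of col_mxKu col_mxKd. Qed.

Lemma Delta_of_A_mx x : Delta_of (A_mx N *m x) = Delta x.
Proof. by rewrite A_mxE /Delta_of col_mxKd. Qed.

Variant bus_volt_spec (k : 'I_nb) :
  ('cV[R]_(npq N) -> 'cV[R]_ng -> R) -> Prop :=
| BusVoltPv i of gen_bus N i = k : bus_volt_spec k (fun _ vg => vg i 0)
| BusVoltPq j of pq_bus j = k : bus_volt_spec k (fun vpq _ => vpq j 0).

(** The projection [f] is chosen before the voltage vectors, so that one case analysis on the bus
    treats the state and both of its bounds together. *)
Lemma bus_voltP k : exists f, bus_volt_spec k f /\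
  forall vpq vg, @bus_volt R nb nl ng nd N vpq vg k = f vpq vg.
Proof.
rewrite /bus_volt; case: pickP => [i /eqP ik|nopv].
  by exists (fun _ vg => vg i 0); split=> //; constructor.
have kpq : k \in pq_buses N.
  by rewrite inE; apply/imsetP => -[i _ ki]; have := nopv i; rewrite -ki eqxx.
exists (fun vpq _ => vpq (enum_rank_in kpq k) 0); split=> [|vpq vg].
  by constructor; rewrite /pq_bus enum_rankK_in.
rewrite (eq_bigl (pred1 (enum_rank_in kpq k))) ?big_pred1_eq // => j /=.
by rewrite /pq_bus -{1}(enum_rankK_in kpq kpq) (inj_eq enum_val_inj).
Qed.

Lemma bus_volt_mono (v v' : 'cV[R]_(npq N)) vg k :
  cvle v v' -> bus_volt v vg k <= bus_volt v' vg k.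
Proof.
by move=> vv'; have [f [[i _|j _] fE]] := bus_voltP k; rewrite !fE.
Qed.

Lemma continuous_bus_volt (T : topologicalType) (h : T -> 'cV[R]_(npq N)) vg k :
  (forall j, continuous (fun t => h t j 0)) ->
  continuous (fun t => bus_volt (h t) vg k).
Proof.
move=> ch t; have [f [[i _|j _] fE]] := bus_voltP k; under eq_fun do rewrite fE.
  exact: cvg_cst.
exact: ch.
Qed.

Section ContinuousPsi.
Context {T : topologicalType} (h : T -> 'cV[R]_(nb + npq N)).
Context (u : 'cV[R]_(ng + ng)).
Hypothesis h_cont : forall j, continuous (fun t => h t j 0).

Lemma continuous_state_blocks j : continuous (fun t => state_blocks (h t) j 0).
Proof. by under eq_fun do rewrite castmxE cast_ord_id; exact: h_cont. Qed.

Lemma continuous_volt k : continuous (fun t => volt (h t) u k 0).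
Proof.
under eq_fun do rewrite mxE; apply: continuous_bus_volt => j.
by under eq_fun do rewrite !mxE; exact: continuous_state_blocks.
Qed.

Lemma continuous_phi l : continuous (fun t => phi (h t) l 0).
Proof.
apply: continuous_mulmx => j; under eq_fun do rewrite !mxE.
exact: continuous_state_blocks.
Qed.

Lemma continuous_Delta : continuous (fun t => Delta (h t)).
Proof.
rewrite /Delta /Delta_of; under eq_fun do rewrite mxE.
exact: continuous_state_blocks.
Qed.

Lemma continuous_psi i : continuous (fun t => psi (h t) u i 0).
Proof.
have cM (f g : T -> R) : continuous f -> continuous g ->
  continuous (fun t => f t * g t).
  by move=> cf cg t; apply: continuousM; [exact: cf | exact: cg].
have ext (f g : T -> R) : g =1 f -> continuous f -> continuous g.
  by move=> /funext ->.
rewrite /psi; case: (split_ordP i) => {}i ->.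
  case: (split_ordP i) => {}i ->.
    case: (split_ordP i) => {}i ->.
      apply: (ext (fun t => pgref u i 0 + alpha N i 0 * Delta (h t))) => [t|t].
        by rewrite !col_mxEu mxE.
      apply: cvgD; first exact: cvg_cst.
      by apply: cvgM; [exact: cvg_cst | exact: continuous_Delta].
    apply: (ext (fun t => volt (h t) u (from_bus N i) 0 *
      volt (h t) u (to_bus N i) 0 * cos (phi (h t) i 0))) => [t|].
      by rewrite !col_mxEu col_mxEd mxE.
    apply: (cM); first by apply: (cM); exact: continuous_volt.
    by move=> t; apply: continuous_comp;
      [exact: continuous_phi | exact: continuous_cos].
  apply: (ext (fun t => volt (h t) u (from_bus N i) 0 *
    volt (h t) u (to_bus N i) 0 * sin (phi (h t) i 0))) => [t|].
    by rewrite col_mxEu col_mxEd mxE.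
  apply: (cM); first by apply: (cM); exact: continuous_volt.
  by move=> t; apply: continuous_comp;
    [exact: continuous_phi | exact: continuous_sin].
apply: (ext (fun t => volt (h t) u i 0 * volt (h t) u i 0)) => [t|].
  by rewrite col_mxEd mxE expr2.
by apply: (cM); exact: continuous_volt.
Qed.

Lemma continuous_residual x0 u0 i :
  continuous (fun t => residual x0 u0 (h t) u i 0).
Proof.
move: i; apply: continuous_addmx; first exact: continuous_psi.
by apply: continuous_oppmx; exact: continuous_mulmx.
Qed.
End ContinuousPsi.

(** The two ends of a line differ, so one of them is not the reference bus, and the angle of that
    bus alone can be tuned. Several lines cannot be treated at once in general, as angle differences
    are dependent around a cycle. *)
Lemma phi_onto (l : 'I_nl) (v : 'cV[R]_(npq N)) (c : R) :
  exists x : 'cV[R]_(nb + npq N), vpq_of (state_blocks x) = v /\ phi x l 0 = c.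
Proof.
have [k Ek] : exists k, Ens N k l != 0.
  have [b [br Eb]] : exists b, b != ref_bus N /\ E N b l != 0.
    have ft := line_ends_neq N l.
    have [fr|fr] := eqVneq (from_bus N l) (ref_bus N).
      exists (to_bus N l); split; first by rewrite -fr eq_sym.
      by rewrite !mxE (negPf ft) eqxx sub0r oppr_eq0 oner_neq0.
    exists (from_bus N l); split=> //.
    by rewrite !mxE eqxx [to_bus N l == _]eq_sym (negPf ft) subr0 oner_neq0.
  case: (unliftP (ref_bus N) b) br Eb => [k -> _ Eb|->]; last by rewrite eqxx.
  by exists k; rewrite mxE.
pose theta : 'cV[R]_nb.-1 := (c / Ens N k l) *: delta_mx k 0.
exists (castmx (state_dim (ref_bus N) (npq N), erefl)
  (col_mx (col_mx theta v) 0)).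
rewrite /phi /state_blocks castmx_comp castmx_id /ang_of /vpq_of !col_mxKu
  col_mxKd.
by split=> //; rewrite -scalemxAr -colE mxE [col _ _ _ _]mxE [_^T _ _]mxE divfK.
Qed.

Lemma mulmx_Cg_mono (a b : 'cV[R]_ng) : cvle a b ->
  cvle (pv_rows N (Cg N) *m a) (pv_rows N (Cg N) *m b).
Proof.
by move=> ab i; rewrite !mxE ler_sum // => j _; rewrite ler_wpM2l // !mxE ler0n.
Qed.

(** At each PV bus the target is a convex combination of the two bus totals, and all generators at
    the bus use its weight. As each generator belongs to exactly one PV bus, indexed by [rk], the
    choices at different buses are independent. *)
Lemma pv_allocation (a b : 'cV[R]_ng) (t : 'cV[R]_(npv N)) :
  cvle a b ->
  cvle (pv_rows N (Cg N) *m a) t -> cvle t (pv_rows N (Cg N) *m b) ->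
  exists q, [/\ cvle a q, cvle q b & pv_rows N (Cg N) *m q = t].
Proof.
move=> ab at_ tb.
have /choice[s sP] i := segment_param (introT andP (conj (at_ i) (tb i))).
have /choice[rk rkP] j : exists i : 'I_(npv N), pv_bus i = gen_bus N j.
  have jpv : gen_bus N j \in pv_buses N by exact: imset_f.
  by exists (enum_rank_in jpv (gen_bus N j)); rewrite /pv_bus enum_rankK_in.
exists (\col_j (s (rk j) * a j 0 + (1 - s (rk j)) * b j 0)); split.
- by move=> j; rewrite mxE; have [/andP[? ?] _] := sP (rk j); have := ab j; nra.
- by move=> j; rewrite mxE; have [/andP[? ?] _] := sP (rk j); have := ab j; nra.
apply/colP => i; rewrite [RHS](sP i).2 !mxE !mulr_sumr -big_split /=.
apply: eq_bigr => j _; rewrite !mxE; case: eqP => [ji|_] /=;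
  last by rewrite !mul0r !mulr0 addr0.
have -> : rk j = i by apply: enum_val_inj; rewrite -!/(pv_bus _) rkP.
by rewrite !mul1r.
Qed.

End Network.

(** * Enclosure of the residuals and basis functions over the state bounds *)

Section Enclosure.
Context {R : realType} {nb nl ng nd : nat} (N : grid R nb nl ng nd).
Variables (x0 : 'cV[R]_(nb + npq N)) (u0 : 'cV[R]_(ng + ng)).
Variable F : envelopes R nb nl ng.
Hypothesis F_convex : convex_envelopes F.
Hypothesis F_enclosing : enclosing_envelopes x0 u0 F.
Variables (u : 'cV[R]_(ng + ng)) (zl zu : 'cV[R]_(nl + npq N + 1)).
Variables (gl gu psil psiu : 'cV[R]_(ng + nl + nl + nb)).
Hypothesis u_dispatch : is_dispatch N u.
Hypothesis gP : residual_bounds u F zl zu gl gu.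
Hypothesis psiP : basis_bounds u F zl zu psil psiu.
Hypothesis v_limits : forall k,
  v_min N k 0 <= bus_volt (vpq_of zl) (vgen u) k /\
  bus_volt (vpq_of zu) (vgen u) k <= v_max N k 0.
Hypothesis phi_limits : forall l,
  phi_min N l 0 <= ang_of zl l 0 /\ ang_of zu l 0 <= phi_max N l 0.

Implicit Types x : 'cV[R]_(nb + npq N).

Definition volts_between x := forall k,
  bus_volt (vpq_of zl) (vgen u) k <= volt x u k 0 <=
    bus_volt (vpq_of zu) (vgen u) k.

Lemma volts_betweenP x : cvle (vpq_of zl) (vpq_of (state_blocks x)) ->
  cvle (vpq_of (state_blocks x)) (vpq_of zu) -> volts_between x.
Proof. by move=> lx xu k; rewrite mxE !bus_volt_mono. Qed.

Lemma volts_between_within x k : volts_between x -> volt_within x u k.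
Proof.
move=> /(_ k)/andP[lv vu]; have [lo hi] := v_limits k.
by rewrite /volt_within (le_trans lo lv) (le_trans vu hi).
Qed.

Lemma phi_between_within x l :
  ang_of zl l 0 <= phi x l 0 <= ang_of zu l 0 -> phi_within x l.
Proof.
move=> /andP[lv vu]; have [lo hi] := phi_limits l.
by rewrite /phi_within (le_trans lo lv) (le_trans vu hi).
Qed.

(** The state is arbitrary: these bounds involve the power setpoint only. *)
Lemma p_between x i :
  p_blk gl i 0 <= p_blk (residual x0 u0 x u) i 0 <= p_blk gu i 0.
Proof.
have [+ _ _] := F_enclosing x u_dispatch => /(_ i)[/andP[lo hi] _].
have [+ _ _] := gP => /(_ i)[lo' hi'].
by rewrite (le_trans lo' lo) (le_trans hi hi').
Qed.

Lemma psip_between x i : Delta_of zl <= Delta x <= Delta_of zu ->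
  p_blk psil i 0 <= p_blk (psi x u) i 0 <= p_blk psiu i 0.
Proof.
move=> D_in; have [+ _ _] := F_enclosing x u_dispatch => /(_ i)[_ /andP[lo hi]].
have [+ _ _ _] := F_convex => /(_ i)[_ _ cc cv].
have [bd _ _] := psiP; apply/andP; split.
- by apply: le_trans lo; apply: (concave2_ge cc D_in) => D /(bd i)[].
- by apply: (le_trans hi); apply: (convex2_le cv D_in) => D /(bd i)[].
Qed.

(** The operational limits put the arguments where the envelopes are valid; convexity above and
    concavity below extend the bounds from the vertices to the whole box of arguments. *)
Lemma line_between x l : volts_between x ->
  ang_of zl l 0 <= phi x l 0 <= ang_of zu l 0 ->
  let g := residual x0 u0 x u in let ps := psi x u in
  [/\ cos_blk gl l 0 <= cos_blk g l 0 <= cos_blk gu l 0,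
      sin_blk gl l 0 <= sin_blk g l 0 <= sin_blk gu l 0,
      cos_blk psil l 0 <= cos_blk ps l 0 <= cos_blk psiu l 0 &
      sin_blk psil l 0 <= sin_blk ps l 0 <= sin_blk psiu l 0].
Proof.
move=> v_in phi_in g ps; have f_in := v_in (from_bus N l);
  have t_in := v_in (to_bus N l).
have within : line_within x u l.
  by split; [exact: volts_between_within|exact: volts_between_within|
    exact: phi_between_within].
have [_ + _] := F_enclosing x u_dispatch.
move=> /(_ l within)[/andP[a1 a2] /andP[a3 a4] /andP[a5 a6] /andP[a7 a8]].
have [_ /(_ l)[c1 c2 c3 c4] /(_ l)[c5 c6 c7 c8] _] := F_convex.
have [_ bg _] := gP; have [_ bp _] := psiP.
split; apply/andP; split.
- by apply: le_trans a1; apply: (concave3_ge c1 f_in t_in phi_in) => p q r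
  /bg/[apply]/[apply][[]].
- by apply: (le_trans a2); apply: (convex3_le c2 f_in t_in phi_in) => p q r
  /bg/[apply]/[apply][[]].
- by apply: le_trans a3; apply: (concave3_ge c3 f_in t_in phi_in) => p q r
  /bg/[apply]/[apply][[]].
- by apply: (le_trans a4); apply: (convex3_le c4 f_in t_in phi_in) => p q r
  /bg/[apply]/[apply][[]].
- by apply: le_trans a5; apply: (concave3_ge c5 f_in t_in phi_in) => p q r
  /bp/[apply]/[apply][[]].
- by apply: (le_trans a6); apply: (convex3_le c6 f_in t_in phi_in) => p q r
  /bp/[apply]/[apply][[]].
- by apply: le_trans a7; apply: (concave3_ge c7 f_in t_in phi_in) => p q r
  /bp/[apply]/[apply][[]].
- by apply: (le_trans a8); apply: (convex3_le c8 f_in t_in phi_in) => p q r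
  /bp/[apply]/[apply][[]].
Qed.

Lemma v_between x k : volts_between x ->
  v_blk gl k 0 <= v_blk (residual x0 u0 x u) k 0 <= v_blk gu k 0 /\
  v_blk psil k 0 <= v_blk (psi x u) k 0 <= v_blk psiu k 0.
Proof.
move=> v_in; have [_ _ +] := F_enclosing x u_dispatch.
move=> /(_ k (volts_between_within k v_in))[/andP[a1 a2] /andP[a3 a4]].
have [_ _ _ /(_ k)[c1 c2 c3 c4]] := F_convex.
have [_ _ bg] := gP; have [_ _ bp] := psiP.
split; apply/andP; split.
- by apply: le_trans a1; apply: (concave1_ge c1 (v_in k)) => v /bg[].
- by apply: (le_trans a2); apply: (convex1_le c2 (v_in k)) => v /bg[].
- by apply: le_trans a3; apply: (concave1_ge c3 (v_in k)) => v /bp[].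
- by apply: (le_trans a4); apply: (convex1_le c4 (v_in k)) => v /bp[].
Qed.

(* Each component is squeezed by the residual at a state which depends on that
   component, since no state x with zl <= A x <= zu is known at this point. *)
Lemma residual_bounds_le : cvle zl zu -> cvle gl gu.
Proof.
move=> /cvle_state[ang_le vpq_le _].
have pick l : exists x,
    volts_between x /\ ang_of zl l 0 <= phi x l 0 <= ang_of zu l 0.
  have [x [xv xphi]] := phi_onto l (vpq_of zl) (ang_of zl l 0).
  by exists x; split;
    [apply: volts_betweenP; rewrite xv | rewrite xphi lexx ang_le].
apply: cvle_blocks => i.
- by have /andP[/le_trans] := p_between 0 i; exact.
- by have [x [xv xphi]] := pick i;
  have [/andP[/le_trans + ?] _ _ _] := line_between xv xphi; exact.
- by have [x [xv xphi]] := pick i;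
  have [_ /andP[/le_trans + ?] _ _] := line_between xv xphi; exact.
(* The voltage block is controlled by the voltages alone, so angles and [Delta] may be set to 0. *)
pose x : 'cV[R]_(nb + npq N) := castmx (state_dim (ref_bus N) (npq N), erefl)
  (col_mx (col_mx 0 (vpq_of zl)) 0).
have xv : vpq_of (state_blocks x) = vpq_of zl.
  by rewrite /state_blocks castmx_comp castmx_id /vpq_of col_mxKu col_mxKd.
have v_in : volts_between x by apply: volts_betweenP; rewrite xv.
by have [/andP[/le_trans + ?] _] := v_between i v_in; exact.
Qed.

Lemma state_enclosure x : cvle zl (A_mx N *m x) -> cvle (A_mx N *m x) zu ->
  [/\ volts_between x, forall l, ang_of zl l 0 <= phi x l 0 <= ang_of zu l 0 &
      Delta_of zl <= Delta x <= Delta_of zu].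
Proof.
move=> /cvle_state[angl vl Dl] /cvle_state[angu vu Du].
move: angl vl Dl angu vu Du; rewrite ang_of_A_mx vpq_of_A_mx Delta_of_A_mx.
move=> angl vl Dl angu vu Du; split; [exact: volts_betweenP|move=> l|].
  by rewrite angl angu.
by rewrite Dl Du.
Qed.

(** The residual part makes the box [[gl, gu]] invariant in the fixed-point argument; the part on
    [psi] is used at the fixed point, for reactive power and line flows. *)
Lemma residual_psi_between x : cvle zl (A_mx N *m x) -> cvle (A_mx N *m x) zu ->
  [/\ cvle gl (residual x0 u0 x u), cvle (residual x0 u0 x u) gu,
      cvle psil (psi x u) & cvle (psi x u) psiu].
Proof.
move=> xl xu; have [v_in phi_in D_in] := state_enclosure xl xu.
have pg i := p_between x i; have pp i := psip_between i D_in.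
have ln l := line_between v_in (phi_in l); have vv k := v_between k v_in.
split; apply: cvle_blocks => i.
- by have /andP[] := pg i.
- by have [/andP[]] := ln i.
- by have [_ /andP[]] := ln i.
- by have [/andP[]] := vv i.
- by have /andP[] := pg i.
- by have [/andP[]] := ln i.
- by have [_ /andP[]] := ln i.
- by have [/andP[]] := vv i.
- by have /andP[] := pp i.
- by have [_ _ /andP[]] := ln i.
- by have [_ _ _ /andP[]] := ln i.
- by have [_ /andP[]] := vv i.
- by have /andP[] := pp i.
- by have [_ _ /andP[]] := ln i.
- by have [_ _ _ /andP[]] := ln i.
- by have [_ /andP[]] := vv i.
Qed.

End Enclosure.

(** * Consequences of the certificate for single loads, and robust feasibility *)

Section Robust.
Context {R : realType} {nb nl ng nd : nat} (N : grid R nb nl ng nd).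

Lemma operational_volt_limits (u : 'cV[R]_(ng + ng))
    (zl zu : 'cV[R]_(nl + npq N + 1)) qgl qgu spf sqf spt sqt k :
  operational_bounds u zl zu qgl qgu spf sqf spt sqt ->
  v_min N k 0 <= bus_volt (vpq_of zl) (vgen u) k /\
  bus_volt (vpq_of zu) (vgen u) k <= v_max N k 0.
Proof.
move=> [gen pq _]; have [f [[i <-|j <-] fE]] := bus_voltP N k; rewrite !fE;
  last exact: pq.
by have [_ _ _ _ /andP[]] := gen i.
Qed.

Lemma centered_radius_bounds n (Sigma Sh : 'M[R]_n) (gamma : R) (r : 'rV[R]_n)
    (w w0 : 'cV[R]_n) :
  cholesky_factor Sigma Sh -> 0 <= gamma ->
  ((w - w0)^T *m invmx Sigma *m (w - w0)) 0 0 <= gamma ^+ 2 ->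
  (r *m w0) 0 0 - gamma * norm2 (r *m Sh) <= (r *m w) 0 0
    <= (r *m w0) 0 0 + gamma * norm2 (r *m Sh).
Proof.
move=> ch g0 /(ler_norm_ellipsoid r ch g0).
rewrite mulmxBr mxE [X in _ + X]mxE ler_norml => /andP[lo hi].
by apply/andP; split; lra.
Qed.

(** The two halves of [flow_bound] give [- s <= L y <= s] at each line, which bounds the square
    without a separate sign condition on [s]. *)
Lemma flow_bound_sqr (L : 'M[R]_(nl, ng + nl + nl + nb)) psil psiu y s l :
  flow_bound L psil psiu s -> cvle psil y -> cvle y psiu ->
  (L *m y) l 0 ^+ 2 <= s l 0 ^+ 2.
Proof.
move=> [up lo] ly yu; have [bl bu] := mulmx_bounds L ly yu.
apply: sqr_le_sym; first exact: le_trans (bu l) (up l).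
apply: le_trans (bl l); have := lo l; rewrite !mxE; lra.
Qed.

End Robust.

Theorem theorem2 (R : realType) (nb nl ng nd : nat) (N : grid R nb nl ng nd)
    (w0 : 'cV[R]_(nd + nd)) (Sigma Sh : 'M[R]_(nd + nd))
    (x0 : 'cV[R]_(nb + npq N)) (u0 : 'cV[R]_(ng + ng))
    (F : envelopes R nb nl ng)
    (Sigma_posdef : posdefmx Sigma)
    (Sh_cholesky : cholesky_factor Sigma Sh)
    (u0_dispatch : is_dispatch N u0)
    (nominal : power_flow x0 u0 w0)
    (Jf_nonsingular : Jf x0 u0 \in unitmx)
    (F_convex : convex_envelopes F)
    (F_enclosing : enclosing_envelopes x0 u0 F)
    (u : 'cV[R]_(ng + ng)) (gamma : R)
    (u_dispatch : is_dispatch N u)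
    (gamma_ge0 : 0 <= gamma) :
  (exists (zu zl : 'cV[R]_(nl + npq N + 1))
      (gu gl psiu psil : 'cV[R]_(ng + nl + nl + nb))
      (qgl qgu : 'cV[R]_ng) (spf sqf spt sqt : 'cV[R]_nl),
    cvle zl zu /\
    [/\ residual_bounds u F zl zu gl gu,
        basis_bounds u F zl zu psil psiu,
        self_mapping x0 u0 w0 Sh gamma zl zu gl gu,
        operational_bounds u zl zu qgl qgu spf sqf spt sqt &
        reactive_bounds N w0 Sh gamma psil psiu qgl qgu /\
        line_flow_bounds N psil psiu spf sqf spt sqt]) ->
  robustly_feasible N (uncertainty_set w0 Sigma gamma) u.
Proof.
case=> zu [zl [gu [gl [psiu [psil [qgl [qgu [spf [sqf [spt [sqt [zlu
  [gP psiP [Kup Klo] opP [[qup qlo] [fpf fqf fpt fqt]]]]]]]]]]]]]]].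
move=> w /= wW.
have [gen_lim _ line_lim] := opP.
have v_lim k := operational_volt_limits k opP.
have phi_lim l :
    phi_min N l 0 <= ang_of zl l 0 /\ ang_of zu l 0 <= phi_max N l 0.
  by have [] := line_lim l.
(* Nonemptiness of the box for Brouwer's theorem. *)
have gl_gu := residual_bounds_le F_convex F_enclosing u_dispatch gP psiP v_lim
  phi_lim zlu.
pose P := invmx (Jf x0 u0).
pose X g : 'cV[R]_(nb + npq N) := - (P *m (M_mx N *m g + R_mx N *m w)).
have AX g : A_mx N *m X g = K_mx x0 u0 *m g - A_mx N *m P *m R_mx N *m w.
  by rewrite /X mulmxN !mulmxDr opprD !mulmxA /K_mx [X in _ = X - _]mulNmx.
have radius_w (r : 'rV_(nd + nd)) := centered_radius_bounds r Sh_cholesky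
  gamma_ge0 wW.
have X_in g : cvle gl g -> cvle g gu ->
    cvle zl (A_mx N *m X g) /\ cvle (A_mx N *m X g) zu.
  move=> gl_g g_gu; have [lo hi] := mulmx_bounds (K_mx x0 u0) gl_g g_gu;
    rewrite AX.
  (* The load term is a linear form on the ellipsoid. The sign in front of it swaps the two bounds,
     which are symmetric about the center. *)
  have xi i : xi_lo x0 u0 w0 Sh gamma i 0 <= - (A_mx N *m P *m R_mx N *m w) i 0
                <= xi_hi x0 u0 w0 Sh gamma i 0.
    rewrite [xi_lo _ _ _ _ _ _ _]mxE [xi_hi _ _ _ _ _ _ _]mxE /xi_center
      /xi_radius -!row_mul.
    have /andP[lw wh] := radius_w (row i (A_mx N *m P *m R_mx N)).
    have -> : (A_mx N *m P *m R_mx N *m w) i 0 =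
      (row i (A_mx N *m P *m R_mx N) *m w) 0 0.
      by rewrite -row_mul [RHS]mxE.
    by rewrite -!row_mul in lw wh *; rewrite /P in lw wh *; apply/andP; split;
      lra.
  split=> i; have /andP[xl xh] := xi i.
    apply: le_trans (Klo i) _; rewrite mxE [leRHS]mxE [X in _ <= _ + X]mxE.
    exact: lerD (lo i) xl.
  apply: le_trans (Kup i); rewrite [leRHS]mxE mxE [X in _ + X <= _]mxE.
  exact: lerD (hi i) xh.
(* Brouwer's theorem is stated for row vectors, hence the transposes. *)
pose f (y : 'rV[R]_(ng + nl + nl + nb)) := (residual x0 u0 (X y^T) u)^T.
have boxP (y : 'rV[R]_(ng + nl + nl + nb)) :
    in_box gl^T gu^T y <-> cvle gl y^T /\ cvle y^T gu.
  split=> [yb|[ly yu] i]; last by have := ly i; have := yu i;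
    rewrite !mxE => -> ->.
  by split=> i; have /andP[] := yb i; rewrite !mxE.
have [|||y [/boxP[ly yu] fy]] := @brouwer_box R _ gl^T gu^T _ f.
- by move=> i; rewrite !mxE.
- move=> y /boxP[ly yu]; have [xl xu] := X_in _ ly yu; apply/boxP;
  rewrite trmxK.
  by have [] := residual_psi_between F_convex F_enclosing u_dispatch gP psiP
    v_lim phi_lim xl xu.
- move=> i; rewrite (_ : (fun y => _) =
      fun y : 'rV[R]_(ng + nl + nl + nb) => residual x0 u0 (X y^T) u i 0);
        last first.
    by apply/funext => y; rewrite [LHS]mxE.
  apply: continuous_residual; apply: continuous_oppmx; apply: continuous_mulmx.
  apply: continuous_addmx => [|j]; last exact: cst_continuous.
  apply: continuous_mulmx => j; rewrite (_ : (fun y => _) =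
      fun y : 'rV[R]_(ng + nl + nl + nb) => y 0 j);
        first exact: coord_continuous.
  by apply/funext => y; rewrite mxE.
pose g := y^T; pose x := X g.
have gE : residual x0 u0 x u = g by rewrite /g -fy trmxK.
have [xl xu] := X_in _ ly yu.
have [_ _ psil_le psiu_ge] := residual_psi_between F_convex F_enclosing
  u_dispatch gP psiP v_lim phi_lim xl xu.
have [v_in phi_in /andP[Dl Du]] := state_enclosure u xl xu.
(* At the fixed point [psi x u = g + Jpsi x], so [M psi = M g + Jf x], and the definition of [X]
   makes this [- R w]. *)
have flow : power_flow x u w.
  rewrite /power_flow -(subrK (Jpsi x0 u0 *m x) (psi x u))
    -/(residual x0 u0 x u) gE.
  rewrite mulmxDr mulmxA -/(Jf x0 u0) /x /X mulmxN mulKVmx //.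
  by rewrite addrAC subrr.
(* The reactive generation that the balance requires at the PV buses. The reactive bounds place it
   between the bus totals of [qgl] and [qgu], hence between those of [qg_min] and [qg_max]. *)
pose t := Lq N *m psi x u + pv_rows N (Cd N) *m qd w.
have zeta i :
    zeta_lo N w0 Sh gamma i 0 <= (pv_rows N (Cd N) *m qd w) i 0 <=
    zeta_hi N w0 Sh gamma i 0.
  rewrite [zeta_lo _ _ _ _ _ _]mxE [zeta_hi _ _ _ _ _ _]mxE /zeta_center
    /zeta_radius.
  (* Padding with zeros on the active loads makes this a linear form in the whole of [w]; its
     product with [Sh] then only sees the reactive rows of the factor. *)
  pose r : 'rV[R]_(nd + nd) := row_mx 0 (row i (pv_rows N (Cd N))).
  have rE p (z : 'M[R]_(nd + nd, p)) :
      r *m z = row i (pv_rows N (Cd N)) *m dsubmx z.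
    by rewrite -{1}[z]vsubmxK mul_row_col mul0mx add0r.
  have := radius_w r; rewrite !rE => /andP[lw wh].
  have -> : (pv_rows N (Cd N) *m qd w) i 0 =
    (row i (pv_rows N (Cd N)) *m qd w) 0 0.
    by rewrite -row_mul [RHS]mxE.
  by rewrite /qd; apply/andP; split.
have [Ll Lu] := mulmx_bounds (Lq N) psil_le psiu_ge.
have [|i|i|qg [ql qu qt]] := @pv_allocation _ _ _ _ _ N (qg_min N) (qg_max N) t.
- exact: qg_min_max.
- apply: le_trans (mulmx_Cg_mono (a := qg_min N) (b := qgl) _ i) _.
    by move=> j; have [] := gen_lim j.
  apply: le_trans (qlo i) _; rewrite mxE [leRHS]mxE.
  apply: lerD; last by have /andP[] := zeta i.
  by apply: le_trans (Ll i); rewrite addrC.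
- apply: (@le_trans _ _ ((pv_rows N (Cg N) *m qgu) i 0)); last first.
    by apply: mulmx_Cg_mono => j; have [] := gen_lim j.
  apply: le_trans (qup i); rewrite mxE [leRHS]mxE.
  by apply: lerD; [exact: Lu | have /andP[] := zeta i].
exists x, qg; split=> //.
  by rewrite /pv_reactive_balance qt addrK.
split=> [i|i|k|l|l].
(* Since [alpha] is nonnegative, generation is nondecreasing in [Delta], and the limits at the two
   ends of its range suffice. *)
- have [pl pu _ _ _] := gen_lim i; have a0 := alpha_ge0 N i.
  by rewrite mxE; apply/andP; split; nra.
- by rewrite ql qu.
- exact: volts_between_within v_lim _ _ v_in.
- exact: phi_between_within phi_lim _ _ (phi_in l).
have [_ _ sf st] := line_lim l.
by split; [apply: le_trans sf | apply: le_trans st]; apply: lerD;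
  exact: flow_bound_sqr psil_le psiu_ge.
Qed.
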